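(* Let $d,k\ge1$ be integers, $q\in[1,\infty]$ (with $1/\infty=0$), $G,R>0$, and $\Theta=\{\theta\in\mathbb R^d:\|\theta\|_q\le R\}$. Then $$\epsilon_k^*(\mathcal F_{G,2},\Theta)\ \ge\ \frac1{12}\Big(1-\frac1q\Big)\frac{GR}{\sqrt k}\min\{d^{1-1/q},\,k^{1-1/q}\}.$$
   Context: $\mathcal F_{G,2}$ is the collection of pairs $(F,P)$ where $F(\theta;x)=\langle\theta,x\rangle$ for $\theta,x\in\mathbb R^d$ and $P$ is a probability distribution on $\mathbb R^d$ with $\mathbb E_P[\|X\|_2^2]\le G^2$. For such a pair, $f(\theta)=\mathbb E_P[F(\theta;X)]$. $\mathcal A_k$ is the class of all (possibly randomized) algorithms that, at each iteration $t=1,\dots,k$, choose a pair of query points $\theta^t,\tau^t\in\mathbb R^d$ as a function of the previous observations and internal randomness, then observe $Y^t=[F(\theta^t;X^t)\ \ F(\tau^t;X^t)]\in\mathbb R^2$, where $X^1,X^2,\dots$ are i.i.d. from $P$ (and independent of the internal randomness), and after $k$ iterations output a point $\widehat\theta(k)\in\Theta$. The minimax error is $$\epsilon_k^*(\mathcal F,\Theta)=\inf_{\mathcal A\in\mathcal A_k}\ \sup_{(F,P)\in\mathcal F}\ \mathbb E\Big[f(\widehat\theta(k))-\inf_{\theta\in\Theta}f(\theta)\Big],$$ the expectation being over the observations and the algorithm's randomness. *)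

(* Defs.v *)
From HB Require Import structures.
From mathcomp Require Import all_boot all_order all_algebra.
From mathcomp Require Import all_classical all_reals all_analysis.

Set Implicit Arguments.
Unset Strict Implicit.
Unset Printing Implicit Defensive.

Import Order.TTheory GRing.Theory Num.Theory.
Import numFieldNormedType.Exports.

Local Open Scope classical_set_scope.
Local Open Scope ring_scope.

(* R^d, as d-tuples: the library's measurable structure on tuples is the
   product of the Borel sigma-algebras, i.e. the Borel sigma-algebra of R^d. *)
Notation vec R d := (d.-tuple R).

Definition dotp (R : realType) (d : nat) (x y : vec R d) : R :=
  \sum_(i < d) tnth x i * tnth y i.

(* The l_q norm for 1 <= q <= +oo; the value at q = -oo is junk. *)
Definition lqnorm (R : realType) (d : nat) (q : \bar R) (x : vec R d) : R :=
  match q with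
  | p%:E%E => (\sum_(i < d) `|tnth x i| `^ p) `^ p^-1
  | +oo%E => \big[Num.max/0]_(i < d) `|tnth x i|
  | -oo%E => 0
  end.

Definition lqball (R : realType) (d : nat) (q : \bar R) (r : R) :
  set (vec R d) := [set x | lqnorm q x <= r].

Section iid_sample.
Context d (T : measurableType d) (R : realType).

Definition tuple_cons (n : nat) (x : T * n.-tuple T) : n.+1.-tuple T :=
  [tuple of x.1 :: x.2].

Lemma measurable_tuple_cons n : measurable_fun setT (@tuple_cons n).
Proof. exact: measurable_cons. Qed.

HB.instance Definition _ n :=
  isMeasurableFun.Build _ _ _ _ (@tuple_cons n) (@measurable_tuple_cons n).

Fixpoint iid (P : probability T R) (n : nat) : probability (n.-tuple T) R :=
  match n with
  | 0 => \d_([tuple] : 0.-tuple T)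
  | m.+1 => distribution (P \x iid P m)%E (@tuple_cons m)
  end.

End iid_sample.

Section minimax.
Context (R : realType) (d : nat).

(* [alg_seed] is the internal randomness; [alg_query t] sees it together with
   the first [t] observations, so iteration [t.+1] of the procedure queries the
   pair of points [alg_query t (u, ys)].  Only [t < k] matters. *)
Record algorithm (k : nat) (Theta : set (vec R d)) := Algorithm {
  alg_disp : measure_display;
  alg_seedType : measurableType alg_disp;
  alg_seed : probability alg_seedType R;
  alg_query : forall t : nat,
    {mfun (alg_seedType * t.-tuple (R * R))%type >-> (vec R d * vec R d)%type};
  alg_output : {mfun (alg_seedType * k.-tuple (R * R))%type >-> vec R d};
  alg_outputP : forall w, Theta (alg_output w)
}.

Section run.
Context (k : nat) (Theta : set (vec R d)) (A : algorithm k Theta).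
Context (F : vec R d -> vec R d -> R).

Fixpoint observations (u : alg_seedType A) (x : nat -> vec R d) (t : nat) :
    t.-tuple (R * R) :=
  match t with
  | 0 => [tuple]
  | s.+1 =>
    let ys := observations u x s in
    let q := alg_query A s (u, ys) in
    [tuple of rcons ys (F q.1 (x s), F q.2 (x s))]
  end.

(* The default of [nth] is never used, since [observations] only reads the
   first [k] samples. *)
Definition estimate (w : alg_seedType A * k.-tuple (vec R d)) : vec R d :=
  alg_output A (w.1, observations w.1 (nth [tuple of nseq d 0] w.2) k).

End run.

Definition objective (F : vec R d -> vec R d -> R)
  (P : probability (vec R d) R) (theta : vec R d) : \bar R := 'E_P[F theta].

Definition optimality_gap k Theta (A : algorithm k Theta)
    (FP : (vec R d -> vec R d -> R) * probability (vec R d) R) : \bar R :=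
  let f := objective FP.1 FP.2 in
  (\int[alg_seed A \x iid FP.2 k]_w
    (f (estimate FP.1 w) - ereal_inf [set f theta | theta in Theta]))%E.

Definition minimax_error (k : nat)
    (C : set ((vec R d -> vec R d -> R) * probability (vec R d) R))
    (Theta : set (vec R d)) : \bar R :=
  ereal_inf [set e | exists A : algorithm k Theta,
                       e = ereal_sup [set optimality_gap A FP | FP in C]].

Definition linear_class (G : R) :
    set ((vec R d -> vec R d -> R) * probability (vec R d) R) :=
  [set FP | FP.1 = @dotp R d /\
    ('E_(FP.2)[fun x => (lqnorm 2%:E x ^+ 2)%R] <= (G ^+ 2)%:E)%E].

End minimax.

Arguments linear_class {R} d G.

(* Main.v *)
From HB Require Import structures.
Require Import Defs.
From mathcomp Require Import all_boot all_order all_algebra.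
From mathcomp Require Import all_classical all_reals all_analysis.
From mathcomp Require Import measurable_realfun ring lra.
Set Implicit Arguments.
Unset Strict Implicit.
Unset Printing Implicit Defensive.
Import Order.TTheory GRing.Theory Num.Theory.
Import numFieldNormedType.Exports.
Local Open Scope classical_set_scope.
Local Open Scope ring_scope.

(* Let m = min(d, k) and, for a sign vector s, let P_s be the law of
   sigma (Z + eps s) restricted to the first m coordinates (the others are 0),
   where Z is a standard Gaussian vector, eps^2 = m / (8 k) and
   sigma^2 = 8 G^2 / (9 m); then E |X|^2 <= G^2. Give s the uniform prior.

   Information. A pair of linear queries only sees the projection Pi Z on a
   subspace of dimension at most 2, so by Cameron-Martin the likelihood of an
   observation under s is a Gaussian exponential of parameter eps Pi s. For a
   family w of unnormalised posterior weights let Psi(w) be the sum, over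
   the coordinates j and the sign vectors s, of
   (w_s - w_s')^2 / (w_s + w_s'), where s' is s with its j-th sign flipped. A
   chi-square computation shows that one round increases the mean of Psi by at
   most 8 eps^2 times the total weight: flipping s_j moves the parameter by
   2 eps |Pi e_j|, and the squares |Pi e_j|^2 add up to at most 2. Hence after k
   rounds the mean of Psi is at most m times the total weight.

   Decision. Given the weights, the posterior mean of s_j has absolute value
   a_j <= 1, and |sum_s w_s s_j| <= |w| / 2 + Psi_j(w) / 4 by AM-GM. By Young's
   inequality, for th in the l_q ball of radius r,
   sum_j |th_j| a_j <= r m^(-1/q) (m / q + (1 - 1/q) sum_j a_j). So the mean
   optimality gap is at least
   sigma eps r m^(-1/q) (1 - 1/q) (m - m/2 - m/4), which is the claim since
   sigma eps = G / (3 sqrt k). *)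

(** * Translation of the one-dimensional Gaussian *)

Section density.
Context d (T : measurableType d) (R : realType).
Variables (nu : {finite_measure set T -> \bar R})
  (mu : {sigma_finite_measure set T -> \bar R}).
Local Open Scope ereal_scope.

(** The Radon-Nikodym derivative and [p] have equal integrals over every measurable set, hence agree
    almost everywhere, and the change of variables for the derivative carries over to [p]. *)
Lemma ge0_integral_density (p : T -> \bar R) (f : T -> \bar R) :
  nu `<< mu -> mu.-integrable [set: T] p -> (forall x, 0 <= p x) ->
  (forall A, measurable A -> nu A = \int[mu]_(x in A) p x) ->
  measurable_fun [set: T] f -> (forall x, 0 <= f x) ->
  \int[nu]_x f x = \int[mu]_x (f x * p x).
Proof.
move=> numu ip p0 nuE mf f0.
rewrite -(Radon_Nikodym_SigmaFinite.change_of_variables numu)//.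
have mRN := measurable_int _ (Radon_Nikodym_SigmaFinite.f_integrable numu).
have RN0 := Radon_Nikodym_SigmaFinite.f_ge0 numu.
apply: ge0_ae_eq_integral => //.
- exact: emeasurable_funM.
- by apply: emeasurable_funM => //; exact: (measurable_int mu).
- by move=> x _; rewrite mule_ge0.
- by move=> x _; rewrite mule_ge0.
- apply: ae_eqe_mul2l; apply: integral_ae_eq => //.
  + exact: Radon_Nikodym_SigmaFinite.f_integrable.
  + exact: (measurable_int mu).
  + by move=> E _ mE; rewrite -Radon_Nikodym_SigmaFinite.f_integral// nuE.
Qed.
End density.

Section gaussian.
Context (R : realType).
Local Notation mu := (@lebesgue_measure R).
Local Open Scope ereal_scope.

(* [normal_prob] lives on [measurableTypeR R], whose display is not that of [R]. *)
Definition to_R (x : measurableTypeR R) : R := x.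

Lemma measurable_to_R : measurable_fun [set: measurableTypeR R] to_R.
Proof. by move=> _ A mA; rewrite setTI. Qed.

HB.instance Definition _ :=
  isMeasurableFun.Build _ _ _ _ to_R measurable_to_R.

Definition stdnormal : probability R R :=
  distribution (normal_prob (0 : R)%R 1%R) to_R.

(** The pushforward of Lebesgue measure by a translation gives every half-open interval its length,
    so by uniqueness it is Lebesgue measure. *)
Lemma ge0_integral_lebesgue_shift (a : R) (f : R -> \bar R) :
  measurable_fun [set: R] f -> (forall x, 0 <= f x) ->
  \int[mu]_x f (x + a)%R = \int[mu]_x f x.
Proof.
move=> mf f0.
pose t := (fun x : measurableTypeR R => (x + a)%R : measurableTypeR R).
have mt : measurable_fun [set: measurableTypeR R] t by exact: measurable_funD.
transitivity (\int[pushforward mu t]_x f x).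
  by rewrite ge0_integral_pushforward.
apply: eq_measure_integral => A mA _ /=.
apply/esym/lebesgue_measure_unique => //= _ [[b c]] _ <-.
rewrite /pushforward.
rewrite (_ : t @^-1` _ = `]b - a, c - a]%classic)%R.
  rewrite !lebesgue_measure_itv/= !lte_fin ltrD2r; case: ifP => // _.
  by rewrite -!EFinD; congr EFin; rewrite opprB addrA subrK.
by apply/seteqP; split => x; rewrite /t /= !in_itv/= ltrBlDr lerBrDr.
Qed.

Lemma ge0_integral_stdnormal (f : R -> \bar R) :
  measurable_fun [set: R] f -> (forall x, 0 <= f x) ->
  \int[stdnormal]_x f x = \int[mu]_x (f x * (normal_pdf 0 1 x)%:E).
Proof.
move=> mf f0; rewrite ge0_integral_distribution//.
apply: (@ge0_integral_density _ (measurableTypeR R) R (normal_prob 0%R 1%R) mu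
  (fun x => (normal_pdf 0 1 x)%:E) f) => //.
- exact: normal_prob_dominates.
- exact: integrable_normal_pdf.
- by move=> x; rewrite lee_fin normal_pdf_ge0.
Qed.

(** Cameron-Martin in dimension one: translate the variable in the Lebesgue integral and complete
    the square. *)
Lemma stdnormal_shift (a : R) (f : R -> \bar R) :
  measurable_fun [set: R] f -> (forall x, 0 <= f x) ->
  \int[stdnormal]_x f (x + a)%R =
  \int[stdnormal]_x (f x * (expR (a * x - a ^+ 2 / 2))%:E).
Proof.
move=> mf f0.
have mfa : measurable_fun [set: R] (fun x => f (x + a)%R).
  by apply: measurableT_comp => //; exact: measurable_funD.
have me : measurable_fun [set: R] (fun x => (expR (a * x - a ^+ 2 / 2))).
  by apply: measurableT_comp => //; apply: measurable_funB.
rewrite ge0_integral_stdnormal// ge0_integral_stdnormal; first last.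
- by move=> x; rewrite mule_ge0// lee_fin expR_ge0.
- by apply: emeasurable_funM => //; exact/measurable_EFinP.
rewrite -[RHS](ge0_integral_lebesgue_shift a); first last.
- by move=> x; rewrite !mule_ge0// lee_fin ?expR_ge0// normal_pdf_ge0.
- apply: emeasurable_funM => //; last first.
    by apply/measurable_EFinP; exact: measurable_normal_pdf.
  by apply: emeasurable_funM => //; exact/measurable_EFinP.
apply: eq_integral => x _; rewrite -muleA; congr (_ * _); rewrite -EFinM.
rewrite !normal_pdfE ?oner_neq0// /normal_fun mulrCA -expRD.
congr (_ * expR _)%:E%R; rewrite !subr0 expr1n; by field.
Qed.
End gaussian.

(** * Gaussian vectors *)

Section measurable_tuples.
Context d1 d2 (T1 : measurableType d1) (T2 : measurableType d2).

Lemma measurable_rcons n (g : T1 -> n.-tuple T2) (f : T1 -> T2) :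
  measurable_fun [set: T1] g -> measurable_fun [set: T1] f ->
  measurable_fun [set: T1] (fun x => [the n.+1.-tuple T2 of rcons (g x) (f x)]).
Proof.
move=> mg mf; apply/measurable_fun_tnthP => i.
have [ltin|] := ltnP i n.
  rewrite (_ : _ \o _ = (fun x => tnth x (Ordinal ltin)) \o g).
    by apply: measurableT_comp => //; exact: measurable_tnth.
  apply/funext => x /=; rewrite (tnth_nth (f x)) (tnth_nth (f x)) /=.
  by rewrite nth_rcons size_tuple ltin.
move=> leni; rewrite (_ : _ \o _ = f)//.
apply/funext => x /=; rewrite (tnth_nth (f x))/= nth_rcons size_tuple.
by rewrite ltnNge leni/= (_ : _ == n)// eqn_leq leni -ltnS ltn_ord.
Qed.

End measurable_tuples.

Lemma measurable_fun_integral_snd d1 d2 (T1 : measurableType d1)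
    (T2 : measurableType d2) (R : realType)
    (m : {sigma_finite_measure set T2 -> \bar R}) (g : T1 -> T2 -> \bar R) :
  measurable_fun [set: T1 * T2] (fun z => g z.1 z.2) ->
  (forall x y, 0 <= g x y)%E ->
  measurable_fun [set: T1] (fun x => \int[m]_y g x y)%E.
Proof.
by move=> mg g0; apply: (measurable_fun_fubini_tonelli_F (m2 := m) _ mg) => z.
Qed.

(** * Iterated integrals over an i.i.d. sample *)

Section iid_integral.
Context d (T : measurableType d) (R : realType) (P : probability T R).
Local Open Scope ereal_scope.

Lemma integral_iid0 (f : 0.-tuple T -> \bar R) :
  measurable_fun [set: 0.-tuple T] f -> \int[iid P 0]_x f x = f [tuple].
Proof. by move=> mf; rewrite integral_dirac// diracT mul1e. Qed.

Lemma ge0_integral_iid_cons n (f : n.+1.-tuple T -> \bar R) :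
  measurable_fun [set: n.+1.-tuple T] f -> (forall x, 0 <= f x) ->
  \int[iid P n.+1]_x f x = \int[P]_x \int[iid P n]_xs f [tuple of x :: xs].
Proof.
move=> mf f0; rewrite ge0_integral_distribution// fubini_tonelli1//.
  by apply: measurableT_comp => //; exact: measurable_tuple_cons.
by move=> x; exact: f0.
Qed.

(** [iid] adds samples in front, whereas the history of an adaptive algorithm grows at the end; the
    backward induction on rounds has to integrate the last sample first. *)
Lemma ge0_integral_iid_rcons n (f : n.+1.-tuple T -> \bar R) :
  measurable_fun [set: n.+1.-tuple T] f -> (forall x, 0 <= f x) ->
  \int[iid P n.+1]_x f x = \int[iid P n]_xs \int[P]_x f [tuple of rcons xs x].
Proof.
elim: n f => [|n IH] f mf f0.
  have mP : measurable_fun [set: 0.-tuple T]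
      (fun xs => \int[P]_x f [tuple of rcons xs x]).
    apply: measurable_fun_integral_snd => //.
    by apply: measurableT_comp => //; exact: measurable_rcons.
  rewrite ge0_integral_iid_cons// integral_iid0//; apply: eq_integral => x _.
  rewrite integral_iid0//; last first.
    by apply: measurableT_comp => //; exact: measurable_cons.
  by congr f; exact: val_inj.
rewrite ge0_integral_iid_cons//.
have mc x : measurable_fun [set: n.+1.-tuple T]
    (fun xs => f [tuple of x :: xs]).
  by apply: measurableT_comp => //; exact: measurable_cons.
under eq_integral => x _ do rewrite IH//.
have mF : measurable_fun [set: n.+1.-tuple T]
    (fun xs => \int[P]_x f [tuple of rcons xs x]).
  apply: measurable_fun_integral_snd => //.
  by apply: measurableT_comp => //; exact: measurable_rcons.
have F0 (xs : n.+1.-tuple T) : 0 <= \int[P]_x f [tuple of rcons xs x].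
  by apply: integral_ge0 => x _; exact: f0.
rewrite [RHS](ge0_integral_iid_cons mF F0).
apply: eq_integral => x _; apply: eq_integral => xs _; apply: eq_integral => y _.
by congr (f _); exact: val_inj.
Qed.

End iid_integral.

Section gaussian_vector.
Context (R : realType).
Local Open Scope ereal_scope.

Definition gauss n : probability (n.-tuple R) R := iid (stdnormal R) n.

Definition translate n (u : 'I_n -> R) (z : n.-tuple R) : n.-tuple R :=
  [tuple (tnth z i + u i)%R | i < n].

(** The density of N(u, I) with respect to N(0, I). *)
Definition shift_density n (u : 'I_n -> R) (z : n.-tuple R) : R :=
  expR (\sum_i u i * tnth z i - (\sum_i u i ^+ 2) / 2).

Lemma measurable_translate n (u : 'I_n -> R) :
  measurable_fun [set: n.-tuple R] (translate u).
Proof.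
apply/measurable_fun_tnthP => i.
rewrite (_ : _ \o _ = fun z => (tnth z i + u i)%R).
  by apply: measurable_funD => //; exact: measurable_tnth.
by apply/funext => z /=; rewrite tnth_mktuple.
Qed.

Lemma measurable_shift_density n (u : 'I_n -> R) :
  measurable_fun [set: n.-tuple R] (shift_density u).
Proof.
apply: measurableT_comp => //; apply: measurable_funB => //.
apply: measurable_sum => i; apply: measurable_funM => //.
exact: measurable_tnth.
Qed.

Lemma shift_density_gt0 n (u : 'I_n -> R) z : (0 < shift_density u z)%R.
Proof. exact: expR_gt0. Qed.

(** Cameron-Martin in dimension [n], by induction: the density is its factor in the first coordinate
    times the density of the others. *)
Lemma ge0_integral_gauss_translate n (u : 'I_n -> R) (f : n.-tuple R -> \bar R) :
  measurable_fun [set: n.-tuple R] f -> (forall x, 0 <= f x) ->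
  \int[gauss n]_z f (translate u z) =
  \int[gauss n]_z (f z * (shift_density u z)%:E).
Proof.
elim: n u f => [|n IH] u f mf f0.
  rewrite !integral_iid0//; last 2 first.
  - apply: emeasurable_funM => //; apply/measurable_EFinP.
    exact: measurable_shift_density.
  - by apply: measurableT_comp => //; exact: measurable_translate.
  rewrite /shift_density !big_ord0 mul0r subr0 expR0 mule1.
  by congr f; exact: tuple0.
have msd m (v : 'I_m -> R) : measurable_fun [set: m.-tuple R]
    (fun z => (shift_density v z)%:E).
  by apply/measurable_EFinP; exact: measurable_shift_density.
have sd0 m (v : 'I_m -> R) z : 0 <= (shift_density v z)%:E.
  by rewrite lee_fin ltW// shift_density_gt0.
pose u' := fun i : 'I_n => u (lift ord0 i).
have tE x (xs : n.-tuple R) : translate u [tuple of x :: xs] =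
    [tuple of (x + u ord0)%R :: translate u' xs].
  apply: eq_from_tnth => i; rewrite tnth_mktuple.
  have [->|i0] := eqVneq i ord0; first by rewrite !tnth0.
  have [j ->] : exists j, i = lift ord0 j.
    by case: (unliftP ord0 i) i0 => [j ->|->]; [exists j|rewrite eqxx].
  by rewrite !tnthS tnth_mktuple.
have dE x (xs : n.-tuple R) : (shift_density u [tuple of x :: xs] =
    expR (u ord0 * x - u ord0 ^+ 2 / 2) * shift_density u' xs)%R.
  rewrite /shift_density -expRD !big_ord_recl tnth0; congr expR.
  under eq_bigr do rewrite tnthS.
  rewrite -/(u' _); set a := (\sum_(i < n) _)%R; set b := (\sum_(i < n) _)%R.
  by field.
rewrite ge0_integral_iid_cons//; last first.
  by apply: measurableT_comp => //; exact: measurable_translate.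
rewrite [RHS]ge0_integral_iid_cons; last 2 first.
- by apply: emeasurable_funM; [exact: mf|exact: msd].
- by move=> z; apply: mule_ge0; [exact: f0|exact: sd0].
have mcons x : measurable_fun [set: n.-tuple R] (fun xs => f [tuple of x :: xs]).
  by apply: measurableT_comp => //; exact: measurable_cons.
(* In [g] the shift of the last [n] coordinates is already a density, so only the first coordinate
   is left for [stdnormal_shift]. *)
pose g x := \int[gauss n]_xs (f [tuple of x :: xs] * (shift_density u' xs)%:E).
have mg : measurable_fun [set: R] g.
  apply: measurable_fun_integral_snd.
    apply: emeasurable_funM.
      by apply: measurableT_comp => //; exact: measurable_cons.
    by apply: (measurableT_comp (msd _ _)).
  by move=> x z; rewrite mule_ge0.
have g0 x : 0 <= g x by apply: integral_ge0 => xs _; rewrite mule_ge0.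
transitivity (\int[stdnormal R]_x g (x + u ord0)%R).
  apply: eq_integral => x _; rewrite /g -IH//.
  by apply: eq_integral => xs _; rewrite tE.
apply: (etrans (stdnormal_shift _ mg g0)); apply: eq_integral => x _.
rewrite /g -ge0_integralZr; last 4 first.
- exact: measurableT.
- by apply: emeasurable_funM; [exact: mcons|exact: msd].
- by move=> xs _; apply: mule_ge0; [exact: f0|exact: sd0].
- by rewrite lee_fin expR_ge0.
apply: eq_integral => xs _; rewrite dE EFinM -muleA; congr (_ * _).
by rewrite muleC.
Qed.

Lemma integral_shift_density n (u : 'I_n -> R) :
  \int[gauss n]_z (shift_density u z)%:E = 1.
Proof.
have m1 : measurable_fun [set: n.-tuple R] (cst (1 : \bar R)).
  exact: measurable_cst.
transitivity (\int[gauss n]_z (cst 1 z * (shift_density u z)%:E)).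
  by apply: eq_integral => z _; rewrite mul1e.
rewrite -(ge0_integral_gauss_translate u m1) => [|z]; last exact: lee01.
rewrite integral_cst// mul1e; exact: probability_setT.
Qed.

Lemma integrable_shift_density n (u : 'I_n -> R) :
  (gauss n).-integrable [set: n.-tuple R] (fun z => (shift_density u z)%:E).
Proof.
apply/integrableP; split.
  by apply/measurable_EFinP; exact: measurable_shift_density.
under eq_integral => z _ do
  rewrite gee0_abs ?lee_fin ?(ltW (shift_density_gt0 _ _))//.
by rewrite integral_shift_density ltry.
Qed.

End gaussian_vector.

(** * Projectors and the chi-square step *)

Section orthogonal_projector.
Context (R : realFieldType) (n : nat).

(** One Gram-Schmidt step: [Q] adds to [P] the rank-one projector onto the part [w] of [a]
    orthogonal to the range of [P]. The equation [P *m Q = P] keeps earlier vectors fixed, and the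
    trace counts dimensions. *)
Lemma orthogonal_projector_extend (P : 'M[R]_n) (a : 'rV[R]_n) :
  P^T = P -> P *m P = P ->
  exists Q : 'M[R]_n, [/\ Q^T = Q, Q *m Q = Q, a *m Q = a, P *m Q = P &
    \tr Q <= \tr P + 1].
Proof.
move=> PT PP; have [w wE] : exists w, w = a - a *m P by exists (a - a *m P).
pose c := (w *m w^T) 0 0.
have wP : w *m P = 0 by rewrite wE mulmxBl -mulmxA PP subrr.
have PwT : P *m w^T = 0 by rewrite -[in LHS]PT -trmx_mul wP trmx0.
have wwT : w *m w^T = c%:M by rewrite [LHS]mx11_scalar.
have [w0|w_neq0] := eqVneq w 0.
  exists P; split => //; last by rewrite lerDl ler01.
  by apply/eqP; rewrite -subr_eq0 -opprB oppr_eq0 -wE w0.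
have c_neq0 : c != 0.
  apply: contra_neq w_neq0 => /eqP; rewrite /c mxE psumr_eq0; last first.
    by move=> i _; rewrite mxE -expr2 sqr_ge0.
  move=> /allP w0; apply/rowP => i; rewrite mxE.
  by apply/eqP; have := w0 i (mem_index_enum _); rewrite mxE mulf_eq0 orbb.
pose E := c^-1 *: (w^T *m w).
have ET : E^T = E by rewrite /E linearZ/= trmx_mul trmxK.
have EE : E *m E = E.
  rewrite /E -scalemxAl -scalemxAr mulmxA -(mulmxA w^T) wwT.
  by rewrite mul_mx_scalar -scalemxAl scalerA scalerA mulVf// mulr1.
have PE : P *m E = 0 by rewrite /E -scalemxAr mulmxA PwT mul0mx scaler0.
have EP : E *m P = 0 by rewrite -[E]ET -[P]PT -trmx_mul PE trmx0.
exists (P + E); split.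
- by rewrite linearD/= PT ET.
- by rewrite mulmxDl !mulmxDr PP PE EP EE addr0 add0r.
- rewrite mulmxDr; suff -> : a *m E = w by rewrite wE addrC subrK.
  rewrite (_ : a = w + a *m P); last by rewrite wE subrK.
  rewrite mulmxDl -(mulmxA a) PE mulmx0 addr0 /E -scalemxAr mulmxA wwT.
  by rewrite mul_scalar_mx scalerA mulVf// scale1r.
- by rewrite mulmxDr PP PE addr0.
- by rewrite linearD/= lerD2l /E linearZ/= mxtrace_mulC wwT mxtrace_scalar mulVf.
Qed.

Lemma projector_pair (a b : 'cV[R]_n) :
  exists P : 'M[R]_n, [/\ P *m a = a, P *m b = b,
    (forall j, \sum_i P j i ^+ 2 <= 1) & \sum_j \sum_i P j i ^+ 2 <= 2].
Proof.
have [|Q [QT QQ aQ _]] := orthogonal_projector_extend a^T (trmx0 R n n).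
  exact: mulmx0.
have [P [PT PP bP QP]] := orthogonal_projector_extend b^T QT QQ.
rewrite mxtrace0 add0r => trP trQ.
(* Symmetry and idempotence turn squared row norms into diagonal entries: they sum to the trace, and
   [P j j ^+ 2 <= P j j] bounds each by 1. *)
have rowP j : \sum_i P j i ^+ 2 = P j j.
  rewrite -[in RHS]PP mxE; apply: eq_bigr => i _.
  by rewrite expr2; congr (_ * _); rewrite -[in LHS]PT mxE.
have tr (c : 'cV[R]_n) : c^T *m P = c^T -> P *m c = c.
  by move=> cP; apply: trmx_inj; rewrite trmx_mul PT.
exists P; split => //.
- by apply: tr; rewrite -aQ -mulmxA QP.
- exact: tr.
- move=> j; rewrite rowP.
  have : P j j ^+ 2 <= P j j.
    rewrite -[leRHS]rowP (bigD1 j)//= lerDl.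
    by apply: sumr_ge0 => i _; exact: sqr_ge0.
  by move=> ?; nra.
- under eq_bigr do rewrite rowP.
  by rewrite -[leLHS]/(\tr P); lra.
Qed.

End orthogonal_projector.

Lemma measurable_fun_div_gt0 d (T : measurableType d) (R : realType)
    (f g : T -> R) : measurable_fun [set: T] f -> measurable_fun [set: T] g ->
  (forall x, 0 < g x) -> measurable_fun [set: T] (fun x => f x / g x).
Proof.
move=> mf mg g0; apply: measurable_funM => //.
rewrite (_ : (fun x => _) = (fun x : R => x `^ (-1)) \o g).
  by apply: measurableT_comp => //; exact: measurable_powR.
by apply/funext => x /=; rewrite powR_inv1// ltW.
Qed.

(** * Triangular discrimination between two Gaussian likelihoods *)

Section chi_square_step.
Context (R : realType) (n : nat).

(* When [x] and [y] are Gaussian likelihoods, so are [x ^+ 2 / y] and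
   [y ^+ 2 / x] up to a constant, hence the right-hand side integrates exactly. *)
Lemma weighted_difference_le (a b x y : R) : 0 < a -> 0 < b -> 0 < x -> 0 < y ->
  (a * x - b * y) ^+ 2 / (a * x + b * y) <=
  (a - b) ^+ 2 / (a + b) ^+ 2 * (a * x + b * y)
  + 4 * (a - b) * a * b / (a + b) ^+ 2 * (x - y)
  + 4 * a ^+ 2 * b ^+ 2 / (a + b) ^+ 4 *
    (a * (x - 2 * y + y ^+ 2 / x) + b * (x ^+ 2 / y - 2 * x + y)).
Proof.
move=> a0 b0 x0 y0.
have s0 : 0 < a + b by rewrite addr_gt0.
have N0 : 0 < a * x + b * y by rewrite addr_gt0// mulr_gt0.
(* With N = ax + by, square the identity (a + b)(ax - by) = (a - b) N + 2ab (x - y) and divide by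
   N. *)
have -> : (a * x - b * y) ^+ 2 / (a * x + b * y) =
  (a - b) ^+ 2 / (a + b) ^+ 2 * (a * x + b * y)
  + 4 * (a - b) * a * b / (a + b) ^+ 2 * (x - y)
  + 4 * a ^+ 2 * b ^+ 2 / (a + b) ^+ 2 * ((x - y) ^+ 2 / (a * x + b * y)).
  by field; rewrite !gt_eqF.
rewrite lerD2l.
have -> : 4 * a ^+ 2 * b ^+ 2 / (a + b) ^+ 4 *
    (a * (x - 2 * y + y ^+ 2 / x) + b * (x ^+ 2 / y - 2 * x + y)) =
  4 * a ^+ 2 * b ^+ 2 / (a + b) ^+ 2 *
  ((x - y) ^+ 2 * ((a / x + b / y) / (a + b) ^+ 2)).
  by field; rewrite !gt_eqF.
(* Cauchy-Schwarz, used to replace the denominator ax + by by a sum of inverses of single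
   likelihoods. *)
have sN : (a + b) ^+ 2 <= (a * x + b * y) * (a / x + b / y).
  rewrite -subr_ge0.
  have -> : (a * x + b * y) * (a / x + b / y) - (a + b) ^+ 2 =
    a * b * (x - y) ^+ 2 / (x * y).
    by field; rewrite !gt_eqF.
  apply: divr_ge0; last by rewrite mulr_ge0 ?ltW.
  by rewrite mulr_ge0 ?sqr_ge0 ?mulr_ge0 ?ltW.
rewrite ler_wpM2l//.
  apply: divr_ge0; last exact: sqr_ge0.
  by rewrite mulr_ge0 ?sqr_ge0// mulr_ge0 ?sqr_ge0.
rewrite ler_wpM2l ?sqr_ge0// ler_pdivlMr ?exprn_gt0// mulrC ler_pdivrMr//.
by rewrite mulrC.
Qed.

(** Completing the square; the constant factor is 1 plus the chi-square divergence of the two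
    Gaussians. *)
Lemma shift_density_sqr_div (u v : 'I_n -> R) z :
  shift_density u z ^+ 2 / shift_density v z =
  expR (\sum_i (u i - v i) ^+ 2) * shift_density (fun i => 2 * u i - v i) z.
Proof.
rewrite /shift_density -expRM_natl -expRB -expRD; congr expR.
transitivity (\sum_i ((2 * u i - v i) * tnth z i - u i ^+ 2 + v i ^+ 2 / 2)).
  rewrite mulrBr mulr_sumr mulr_natl -[_ / 2 *+ 2]mulr_natr divfK ?pnatr_eq0//.
  rewrite mulr_suml opprB addrCA [LHS]addrC -!sumrB -big_split/=.
  by apply: eq_bigr => i _; ring.
rewrite mulr_suml -sumrB -big_split/=.
by apply: eq_bigr => i _; field.
Qed.

Lemma integral_shift_density_combination (s : seq (R * ('I_n -> R))) :
  (\int[gauss R n]_z (\sum_(p <- s) p.1 * shift_density p.2 z)%:E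
  = (\sum_(p <- s) p.1)%:E)%E.
Proof.
have id v := @integrable_shift_density R n v.
transitivity (\int[gauss R n]_z
    \sum_(p <- s) (p.1%:E * (shift_density p.2 z)%:E))%E.
  by apply: eq_integral => z _; rewrite -sumEFin.
rewrite integral_sum; last 2 first.
- exact: measurableT.
- by move=> p; apply: integrableZl; [exact: measurableT|exact: id].
rewrite -sumEFin; apply: eq_bigr => p _.
rewrite integralZl; last 2 first.
- exact: measurableT.
- exact: id.
by rewrite integral_shift_density mule1.
Qed.

Lemma integral_weighted_difference (a b : R) (u v : 'I_n -> R) :
  0 < a -> 0 < b ->
  (\int[gauss R n]_z ((a * shift_density u z - b * shift_density v z) ^+ 2 /
    (a * shift_density u z + b * shift_density v z))%:E <=
  ((a - b) ^+ 2 / (a + b) +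
   (a + b) / 4 * (expR (\sum_i (u i - v i) ^+ 2) - 1))%:E)%E.
Proof.
move=> a0 b0; set X := expR _.
have s0 : 0 < a + b by rewrite addr_gt0.
have uvX : expR (\sum_i (v i - u i) ^+ 2) = X.
  by congr expR; apply: eq_bigr => i _; rewrite -sqrrN opprB.
pose c := 4 * a ^+ 2 * b ^+ 2 / (a + b) ^+ 4.
(* The coefficients of the pointwise bound, grouped by the four Gaussian parameters that occur in
   it. *)
pose s := [::
  ((a - b) ^+ 2 / (a + b) ^+ 2 * a + 4 * (a - b) * a * b / (a + b) ^+ 2
     + c * (a - 2 * b), u);
  ((a - b) ^+ 2 / (a + b) ^+ 2 * b - 4 * (a - b) * a * b / (a + b) ^+ 2
     + c * (b - 2 * a), v);
  (c * a * X, fun i => 2 * v i - u i); (c * b * X, fun i => 2 * u i - v i)].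
apply: (@le_trans _ _
  (\int[gauss R n]_z (\sum_(p <- s) p.1 * shift_density p.2 z)%:E)%E).
  have md w := @measurable_shift_density R n w.
  have d0 w z := @shift_density_gt0 R n w z.
  have N0 z : 0 < a * shift_density u z + b * shift_density v z.
    by rewrite addr_gt0 ?mulr_gt0.
  apply: ge0_le_integral.
  - exact: measurableT.
  - by move=> z _; rewrite lee_fin divr_ge0 ?sqr_ge0 ?ltW.
  - apply/measurable_EFinP; apply: measurable_fun_div_gt0 => //.
      apply: measurable_funX; apply: measurable_funB;
      by apply: measurable_funM => //; exact: md.
    apply: measurable_funD;
    by apply: measurable_funM => //; exact: md.
  - apply/measurable_EFinP; apply: measurable_sum => p.
    by apply: measurable_funM => //; exact: md.
  - move=> z _; rewrite lee_fin.
    apply: (le_trans (weighted_difference_le a0 b0 (d0 u z) (d0 v z))).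
    rewrite !shift_density_sqr_div uvX -/X /s !big_cons big_nil/= -/c.
    by rewrite le_eqVlt; apply/orP; left; apply/eqP; ring.
rewrite integral_shift_density_combination lee_fin /s !big_cons big_nil/=.
have X1 : 1 <= X.
  rewrite -expR0 ler_expR; apply: sumr_ge0 => i _; exact: sqr_ge0.
(* This is [4 * a * b <= (a + b) ^+ 2], squared. *)
have c4 : c <= 1 / 4.
  rewrite /c ler_pdivrMr ?exprn_gt0// -subr_ge0.
  rewrite (_ : _ - _ = (a - b) ^+ 2 * (4 * a * b + (a + b) ^+ 2) / 4).
    by rewrite divr_ge0// mulr_ge0 ?sqr_ge0// addr_ge0 ?sqr_ge0 ?mulr_ge0 ?ltW.
  by field.
(* Every density has mass one, so the term in [x - y] cancels and the last one leaves [X - 1] for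
   each of [a] and [b]. *)
rewrite [leLHS](_ : _ = (a - b) ^+ 2 / (a + b) + (a + b) * (X - 1) * c).
  rewrite lerD2l [leRHS]mulrAC ler_wpM2l//.
    by apply: mulr_ge0; [exact: ltW|rewrite subr_ge0].
  by rewrite (le_trans c4)// div1r.
by field; rewrite gt_eqF.
Qed.

(** From exp(-x) >= 1 - x one gets exp x <= 1 / (1 - x), which is at most 1 + 2x on this range. *)
Lemma expR_le1D2x (x : R) : 0 <= x <= 1 / 2 -> expR x <= 1 + 2 * x.
Proof.
move=> /andP[x0 x1].
have := expR_ge1Dx (- x); rewrite expRN => h.
have e0 := expR_gt0 x.
have : (1 - x) * expR x <= 1 by rewrite -ler_pdivlMr// div1r.
by move=> ?; nra.
Qed.

End chi_square_step.

(** * Potential on the hypercube *)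

Section hypercube_potential.
Context (R : realType) (n : nat) (J : pred 'I_n).
Implicit Types (s : {ffun 'I_n -> bool}) (w : {ffun 'I_n -> bool} -> R).

Definition sgn s i : R := (-1) ^+ s i.

Definition flip (j : 'I_n) s : {ffun 'I_n -> bool} :=
  [ffun i => if i == j then ~~ s i else s i].

Lemma flipK j : involutive (flip j).
Proof. by move=> s; apply/ffunP => i; rewrite !ffunE; case: eqP; rewrite ?negbK. Qed.

Lemma sum_flip j w : \sum_s w (flip j s) = \sum_s w s.
Proof. by rewrite [RHS](reindex_inj (inv_inj (flipK j))). Qed.

Lemma sgn_flip j s i : sgn (flip j s) i = if i == j then - sgn s i else sgn s i.
Proof. by rewrite /sgn ffunE; case: eqP => // _; rewrite signrN. Qed.

(* Each term of the inner sum is a triangular discrimination between the weights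
   of two neighbours of the hypercube. *)
Definition potential w : R :=
  \sum_(j | J j) \sum_s (w s - w (flip j s)) ^+ 2 / (w s + w (flip j s)).

Lemma potential_ge0 w : (forall s, 0 < w s) -> 0 <= potential w.
Proof.
move=> w0; apply: sumr_ge0 => j _; apply: sumr_ge0 => s _.
by rewrite divr_ge0 ?sqr_ge0// ltW// addr_gt0.
Qed.

Lemma potential_cst (c : R) : potential (fun=> c) = 0.
Proof.
by apply: big1 => j _; apply: big1 => s _; rewrite subrr expr0n mul0r.
Qed.

Definition drift (eps : R) (P : 'M[R]_n) s (i : 'I_n) : R :=
  eps * \sum_j sgn s j * P j i.

(** Flipping sign [j] changes the drift by [2 * eps] times row [j] of [P], up to sign. *)
Lemma sum_sqr_drift_flip eps P j s :
  \sum_i (drift eps P s i - drift eps P (flip j s) i) ^+ 2 =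
  4 * eps ^+ 2 * \sum_i P j i ^+ 2.
Proof.
rewrite mulr_sumr; apply: eq_bigr => i _.
rewrite /drift -mulrBr -sumrB (bigD1 j)//= sgn_flip eqxx big1 => [|l lj].
  have : sgn s j ^+ 2 = 1 by rewrite /sgn sqrr_sign.
  rewrite addr0 => s1; rewrite (_ : _ ^+ 2 = 4 * eps ^+ 2 * P j i ^+ 2 * sgn s j ^+ 2).
    by rewrite s1 mulr1.
  ring.
by rewrite sgn_flip (negbTE lj) subrr.
Qed.

Local Notation like eps P s := (@shift_density R n (drift eps P s)).

Lemma measurable_potential_like (eps : R) (P : 'M[R]_n) w : (forall s, 0 < w s) ->
  measurable_fun [set: n.-tuple R]
    (fun z => potential (fun s => w s * like eps P s z)).
Proof.
move=> w0; have mL s : measurable_fun [set: n.-tuple R]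
    (fun z => w s * like eps P s z).
  by apply: measurable_funM => //; exact: measurable_shift_density.
rewrite /potential; under eq_fun do rewrite big_mkcond /=.
apply: measurable_sum => j; case: (J j) => //; apply: measurable_sum => s.
apply: measurable_fun_div_gt0.
- by apply: measurable_funX; apply: measurable_funB; exact: mL.
- by apply: measurable_funD; exact: mL.
- by move=> z; rewrite addr_gt0// mulr_gt0// shift_density_gt0.
Qed.

Lemma integral_potential_le (eps : R) (P : 'M[R]_n) w : eps ^+ 2 <= 1 / 8 ->
  (forall j, \sum_i P j i ^+ 2 <= 1) -> \sum_j \sum_i P j i ^+ 2 <= 2 ->
  (forall s, 0 < w s) ->
  (\int[gauss R n]_z (potential (fun s => w s * like eps P s z))%:E <=
   (potential w + 8 * eps ^+ 2 * \sum_s w s)%:E)%E.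
Proof.
move=> eps8 P1 P2 w0.
pose D j s z := (w s * like eps P s z - w (flip j s) * like eps P (flip j s) z) ^+ 2 /
  (w s * like eps P s z + w (flip j s) * like eps P (flip j s) z).
have L0 s z : 0 < w s * like eps P s z.
  by apply: mulr_gt0; [exact: w0|exact: shift_density_gt0].
have mL s : measurable_fun [set: n.-tuple R] (fun z => w s * like eps P s z).
  by apply: measurable_funM => //; exact: measurable_shift_density.
have D0 j s z : 0 <= D j s z.
  by rewrite divr_ge0 ?sqr_ge0// ltW// addr_gt0.
have mD j s : measurable_fun [set: n.-tuple R] (fun z => (D j s z)%:E).
  apply/measurable_EFinP; apply: measurable_fun_div_gt0.
  - by apply: measurable_funX; apply: measurable_funB; exact: mL.
  - by apply: measurable_funD; exact: mL.
  - by move=> z; exact: addr_gt0.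
have DE j s : (\int[gauss R n]_z (D j s z)%:E <=
    ((w s - w (flip j s)) ^+ 2 / (w s + w (flip j s)) +
     (w s + w (flip j s)) * (2 * eps ^+ 2 * \sum_i P j i ^+ 2))%:E)%E.
  apply: (le_trans (integral_weighted_difference _ _ (w0 s) (w0 _))).
  rewrite lee_fin lerD2l -[_ / 4 * _]mulrA ler_wpM2l//.
    by rewrite ltW// addr_gt0.
  rewrite sum_sqr_drift_flip.
  have N0 : 0 <= \sum_i P j i ^+ 2 by apply: sumr_ge0 => i _; exact: sqr_ge0.
  move: N0 (P1 j); set N := \sum_i P j i ^+ 2 => N0 N1.
  (* Here [eps ^+ 2 <= 1 / 8] and the row bound [N <= 1] bring the exponent into the range where the
     exponential is linearised. *)
  have /expR_le1D2x : 0 <= 4 * eps ^+ 2 * N <= 1 / 2.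
    move: (eps ^+ 2) (sqr_ge0 eps) eps8 => e e0 e8.
    by apply/andP; split; nra.
  by move=> ?; lra.
have -> : (\int[gauss R n]_z (potential (fun s => w s * like eps P s z))%:E =
    \sum_(j | J j) \sum_s \int[gauss R n]_z (D j s z)%:E)%E.
  transitivity (\int[gauss R n]_z
      \sum_j (if J j then \sum_s (D j s z)%:E else 0))%E.
    apply: eq_integral => z _; rewrite -big_mkcond /potential -sumEFin/=.
    by apply: eq_bigr => j _; rewrite -sumEFin.
  rewrite ge0_integral_sum; last 3 first.
  - exact: measurableT.
  - by move=> j; case: (J j) => //; apply: emeasurable_sum => s; exact: mD.
  - move=> j z _; case: (J j) => //; apply: sume_ge0 => s _.
    by rewrite lee_fin.
  rewrite [RHS]big_mkcond; apply: eq_bigr => j _; case: (J j); last first.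
    exact: integral0.
  rewrite ge0_integral_sum//.
  by move=> s z _; rewrite lee_fin.
apply: (@le_trans _ _ (\sum_(j | J j) (\sum_s
   ((w s - w (flip j s)) ^+ 2 / (w s + w (flip j s)) +
     (w s + w (flip j s)) * (2 * eps ^+ 2 * \sum_i P j i ^+ 2)))%:E)%E).
  apply: lee_sum => j _; rewrite -sumEFin; apply: lee_sum => s _; exact: DE.
rewrite sumEFin lee_fin /potential.
under eq_bigr => j _ do rewrite big_split/= -mulr_suml big_split/= sum_flip.
rewrite big_split/= lerD2l -mulr_sumr -mulr_sumr.
have W0 : 0 <= \sum_s w s by apply: sumr_ge0 => s _; exact: ltW.
have : \sum_(j | J j) \sum_i P j i ^+ 2 <= 2.
  apply: le_trans P2; rewrite [leRHS](bigID J)/= lerDl.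
  by apply: sumr_ge0 => j _; apply: sumr_ge0 => i _; exact: sqr_ge0.
set N := \sum_(j | J j) _ => N2.
have e0 := sqr_ge0 eps.
(* The constant 8 is 2 * 2 * 2: each weight counts for itself and for its flip, the linearised
   exponential gives 2, and the squared rows of [P] add up to at most 2. *)
have -> : 8 * eps ^+ 2 * \sum_s w s =
  (\sum_s w s + \sum_s w s) * (2 * eps ^+ 2 * 2) by ring.
by rewrite ler_wpM2l ?addr_ge0// ler_wpM2l// mulr_ge0.
Qed.

(* [h s] is the expected loss under [s]: this bounds the Bayes risk for every
   unnormalised prior [w] at once, which is what backward induction needs, as the
   posterior of one round is the prior of the next. *)
Definition bayes_bound (alpha beta : R) (h : {ffun 'I_n -> bool} -> \bar R) :=
  forall w, (forall s, 0 < w s) ->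
  ((alpha * \sum_s w s)%:E <=
   \sum_s (w s)%:E * h s + (beta * potential w)%:E)%E.

Lemma le_bayes_bound alpha beta g h : (forall s, g s <= h s)%E ->
  bayes_bound alpha beta g -> bayes_bound alpha beta h.
Proof.
move=> gh bg w w0; apply: (le_trans (bg w w0)); apply: leeD => //.
by apply: lee_sum => s _; apply: lee_wpmul2l => //; rewrite lee_fin ltW.
Qed.

(** For each [z] the hypothesis is applied to the posterior weights [w s * like eps P s z]. On
    integrating, the total weight is preserved and the growth of the potential is charged to
    [alpha]. *)
Lemma bayes_bound_gauss (eps : R) (P : 'M[R]_n) alpha beta
    (g : {ffun 'I_n -> bool} -> n.-tuple R -> \bar R) :
  eps ^+ 2 <= 1 / 8 ->
  (forall j, \sum_i P j i ^+ 2 <= 1) -> \sum_j \sum_i P j i ^+ 2 <= 2 ->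
  0 <= alpha -> 0 <= beta ->
  (forall s, measurable_fun [set: n.-tuple R] (g s)) ->
  (forall s z, 0 <= g s z)%E ->
  (forall z, bayes_bound alpha beta (g^~ z)) ->
  bayes_bound (alpha - 8 * eps ^+ 2 * beta) beta
    (fun s => \int[gauss R n]_z (g s z * (like eps P s z)%:E))%E.
Proof.
move=> eps8 P1 P2 a0 b0 mg g0 hg w w0.
have L0 s z : 0 < like eps P s z by exact: shift_density_gt0.
have wL0 s z : 0 < w s * like eps P s z by exact: mulr_gt0.
have mL s : measurable_fun [set: n.-tuple R] (fun z => (like eps P s z)%:E).
  by apply/measurable_EFinP; exact: measurable_shift_density.
have mgL s : measurable_fun [set: n.-tuple R]
    (fun z => (g s z * (like eps P s z)%:E)%E).
  by apply: emeasurable_funM; [exact: mg|exact: mL].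
have gL0 s z : (0 <= g s z * (like eps P s z)%:E)%E.
  by apply: mule_ge0; [exact: g0|rewrite lee_fin ltW].
have mpot := measurable_potential_like eps P w0.
have pot0 z : 0 <= potential (fun s => w s * like eps P s z).
  exact: potential_ge0.
have step : ((alpha * \sum_s w s)%:E <=
    \sum_s (w s)%:E * \int[gauss R n]_z (g s z * (like eps P s z)%:E) +
    beta%:E * \int[gauss R n]_z (potential (fun s => w s * like eps P s z))%:E)%E.
  (* Total prior weight equals mean total posterior weight, so the claim becomes a comparison of
     integrands. *)
  have -> : ((alpha * \sum_s w s)%:E = \int[gauss R n]_z
      (\sum_(p <- [seq (alpha * w s, drift eps P s) | s <- index_enum _])
        p.1 * shift_density p.2 z)%:E)%E.
    by rewrite integral_shift_density_combination big_map mulr_sumr.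
  under eq_bigr => s _ do rewrite -ge0_integralZl_EFin ?ltW//.
  rewrite -ge0_integralZl_EFin//; last 2 first.
  - by move=> z _; rewrite lee_fin.
  - exact/measurable_EFinP.
  rewrite -ge0_integral_sum//; last 2 first.
  - by move=> s; apply: emeasurable_funM => //.
  - by move=> s z _; apply: mule_ge0 => //; rewrite lee_fin ltW.
  rewrite -ge0_integralD//; last 4 first.
  - move=> z _; apply: sume_ge0 => s _.
    by apply: mule_ge0 => //; rewrite lee_fin ltW.
  - by apply: emeasurable_sum => s; apply: emeasurable_funM.
  - by move=> z _; rewrite mule_ge0 ?lee_fin.
  - by apply: emeasurable_funM => //; exact/measurable_EFinP.
  apply: ge0_le_integral => //.
  - move=> z _; rewrite lee_fin big_map; apply: sumr_ge0 => s _ /=.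
    by rewrite -mulrA; apply: mulr_ge0 => //; exact: ltW.
  - apply/measurable_EFinP; apply: measurable_sum => p.
    by apply: measurable_funM => //; exact: measurable_shift_density.
  - apply: emeasurable_funD.
      by apply: emeasurable_sum => s; apply: emeasurable_funM.
    by apply: emeasurable_funM => //; exact/measurable_EFinP.
  - move=> z _; rewrite big_map/=.
    have := hg z _ (wL0^~ z); rewrite mulr_sumr EFinM.
    congr (_ <= _ + _)%E.
      by congr EFin; apply: eq_bigr => s _; rewrite mulrA.
    by apply: eq_bigr => s _; rewrite EFinM -muleA [(g s z * _)%E]muleC.
have := integral_potential_le eps8 P1 P2 w0.
set I := (\int[_]_z (potential _)%:E)%E => Ile.
have {}step := le_trans step (leeD2l _ (lee_wpmul2l _ Ile)).
have {step} := step (ltac:(by rewrite lee_fin) : (0 <= beta%:E)%E).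
(* The risk may be infinite: nonnegativity excludes -oo, the value +oo is trivial, and a finite
   value allows real arithmetic. *)
have : (0 <= \sum_s (w s)%:E *
    \int[gauss R n]_z (g s z * (like eps P s z)%:E))%E.
  apply: sume_ge0 => s _; apply: mule_ge0; first by rewrite lee_fin ltW.
  by apply: integral_ge0 => z _; exact: gL0.
case: (\sum_s _ * _)%E => [x|_ _|//].
  by rewrite -EFinM -!EFinD !lee_fin => _ ?; lra.
by rewrite addye// leey.
Qed.

End hypercube_potential.

(** * One round of linear observations *)

Section linear_observations.
Context (R : realType) (n : nat) (J : pred 'I_n) (sigma eps : R).
Implicit Types (s : {ffun 'I_n -> bool}).

Definition sample s (z : n.-tuple R) : n.-tuple R :=
  [tuple if J i then sigma * (tnth z i + eps * sgn R s i) else 0 | i < n].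

Lemma measurable_sample s : measurable_fun [set: n.-tuple R] (sample s).
Proof.
apply/measurable_fun_tnthP => i.
rewrite (_ : _ \o _ = fun z => if J i then sigma * (tnth z i + eps * sgn R s i)
  else 0); last by apply/funext => z /=; rewrite tnth_mktuple.
case: (J i) => //; apply: measurable_funM => //; apply: measurable_funD => //.
exact: measurable_tnth.
Qed.

HB.instance Definition _ s :=
  isMeasurableFun.Build _ _ _ _ (sample s) (measurable_sample s).

Definition sample_law s : probability (n.-tuple R) R :=
  distribution (gauss R n) (sample s).

(** Scale and support of the sample are moved onto the query, so that an observation is a linear
    form in a shifted standard Gaussian. *)
Definition effective_query (th : n.-tuple R) (i : 'I_n) : R :=
  if J i then sigma * tnth th i else 0.

Lemma dotp_sample s th z : dotp th (sample s z) =
  \sum_i effective_query th i * (tnth z i + eps * sgn R s i).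
Proof.
apply: eq_bigr => i _; rewrite tnth_mktuple /effective_query.
by case: (J i); rewrite ?mulr0 ?mul0r// mulrCA mulrA.
Qed.

Lemma measurable_dotp d (T : measurableType d) (f g : T -> n.-tuple R) :
  measurable_fun [set: T] f -> measurable_fun [set: T] g ->
  measurable_fun [set: T] (fun x => dotp (f x) (g x)).
Proof.
move=> mf mg; apply: measurable_sum => i; apply: measurable_funM.
- exact: (measurableT_comp (measurable_tnth i)).
- exact: (measurableT_comp (measurable_tnth i)).
Qed.

Lemma measurable_linear_form (a : 'I_n -> R) :
  measurable_fun [set: n.-tuple R] (fun z => \sum_i a i * tnth z i).
Proof.
by apply: measurable_sum => i; apply: measurable_funM => //; exact: measurable_tnth.
Qed.

(* Two linear forms do not see the component of the shift orthogonal to them, so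
   only its projection to their span enters the likelihood. *)
Lemma integral_linear_forms_shift (a b : 'I_n -> R) :
  exists P : 'M[R]_n, [/\ forall j, \sum_i P j i ^+ 2 <= 1,
    \sum_j \sum_i P j i ^+ 2 <= 2 &
    forall s (H : R * R -> \bar R), measurable_fun [set: R * R] H ->
    (forall y, 0 <= H y)%E ->
    (\int[gauss R n]_z H (\sum_i a i * (tnth z i + eps * sgn R s i),
                        \sum_i b i * (tnth z i + eps * sgn R s i))%R =
    \int[gauss R n]_z (H (\sum_i a i * tnth z i, \sum_i b i * tnth z i)%R *
      (shift_density (drift eps P s) z)%:E))%E].
Proof.
have [P [Pa Pb P1 P2]] := projector_pair (\col_i a i) (\col_i b i).
exists P; split => // s H mH H0.
(* A form fixed by [P] pairs equally with [eps] times the signs and with their image under [P]. *)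
have driftE (c : 'I_n -> R) z : P *m \col_i c i = \col_i c i ->
    \sum_i c i * (tnth z i + eps * sgn R s i) =
    \sum_i c i * tnth (translate (drift eps P s) z) i.
  move=> Pc; under [RHS]eq_bigr do rewrite tnth_mktuple mulrDr.
  under [LHS]eq_bigr do rewrite mulrDr.
  rewrite !big_split/=; congr +%R.
  rewrite /drift; under [RHS]eq_bigr do rewrite mulrCA mulr_sumr.
  rewrite -mulr_sumr exchange_big/= mulr_sumr; apply: eq_bigr => j _.
  have := congr1 (fun M : 'cV[R]_n => M j 0) Pc; rewrite !mxE => cj.
  rewrite -[in LHS]cj mulr_suml mulr_sumr; apply: eq_bigr => i _.
  by rewrite mxE; ring.
pose f z := H (\sum_i a i * tnth z i, \sum_i b i * tnth z i).
have mf : measurable_fun [set: n.-tuple R] f.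
  apply: measurableT_comp => //; apply: measurable_fun_pair;
  exact: measurable_linear_form.
rewrite -(ge0_integral_gauss_translate (drift eps P s) mf); last first.
  by move=> z; exact: H0.
by apply: eq_integral => z _; rewrite !driftE.
Qed.

Local Notation S := {ffun 'I_n -> bool}.

Lemma bayes_bound_round (th tau : n.-tuple R) alpha beta
    (h : S -> R * R -> \bar R) :
  eps ^+ 2 <= 1 / 8 -> 0 <= alpha -> 0 <= beta ->
  (forall s, measurable_fun [set: R * R] (h s)) ->
  (forall s y, 0 <= h s y)%E ->
  (forall y, bayes_bound J alpha beta (h^~ y)) ->
  bayes_bound J (alpha - 8 * eps ^+ 2 * beta) beta
    (fun s => \int[sample_law s]_x h s (dotp th x, dotp tau x))%E.
Proof.
move=> eps8 a0 b0 mh h0 hb.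
pose a := effective_query th; pose b := effective_query tau.
have [P [P1 P2 HP]] := integral_linear_forms_shift a b.
pose g s z := h s (\sum_i a i * tnth z i, \sum_i b i * tnth z i).
have mg s : measurable_fun [set: n.-tuple R] (g s).
  apply: measurableT_comp => //; apply: measurable_fun_pair;
  exact: measurable_linear_form.
have g0 s z : (0 <= g s z)%E by exact: h0.
have hE s : (\int[sample_law s]_x h s (dotp th x, dotp tau x) =
    \int[gauss R n]_z (g s z * (shift_density (drift eps P s) z)%:E))%E.
  rewrite ge0_integral_distribution; last 2 first.
  - apply: measurableT_comp => //; apply: measurable_fun_pair;
    exact: measurable_dotp.
  - by move=> x; exact: h0.
  rewrite -(HP s _ (mh s) (h0 s)); apply: eq_integral => z _ /=.
  by rewrite !dotp_sample.
apply: le_bayes_bound (bayes_bound_gauss eps8 P1 P2 a0 b0 mg g0 (fun z => hb _)).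
by move=> s; rewrite hE.
Qed.

End linear_observations.

(** * Adaptive runs *)

Section adaptive_run.
Context (R : realType) (n k : nat) (Theta : set (n.-tuple R)).
Context (A : algorithm k Theta).
Local Notation x0 := ([tuple of nseq n 0] : n.-tuple R).

Lemma observations_eq F u (x y : nat -> n.-tuple R) t :
  (forall i, (i < t)%N -> x i = y i) ->
  observations (A := A) F u x t = observations F u y t.
Proof.
elim: t => //= t IH xy; rewrite IH => [|i it]; last exact/xy/ltnW.
by rewrite xy.
Qed.

Lemma observations_rcons F u t (xs : t.-tuple (n.-tuple R)) x :
  observations (A := A) F u (nth x0 [tuple of rcons xs x]) t.+1 =
  let ys := observations F u (nth x0 xs) t in
  let q := alg_query A t (u, ys) in
  [tuple of rcons ys (F q.1 x, F q.2 x)].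
Proof.
rewrite /= nth_rcons size_tuple ltnn eqxx.
rewrite (@observations_eq F u _ (nth x0 xs)) => [//|i it].
by rewrite nth_rcons size_tuple it.
Qed.

Lemma measurable_nth d (T : measurableType d) (m i : nat) (y0 : T) :
  measurable_fun [set: m.-tuple T] (fun ys : m.-tuple T => nth y0 ys i).
Proof.
have [im|mi] := ltnP i m.
  rewrite (_ : (fun ys => _) = (fun ys : m.-tuple T => tnth ys (Ordinal im))).
    exact: measurable_tnth.
  by apply/funext => ys; rewrite (tnth_nth y0).
rewrite (_ : (fun ys => _) = cst y0)//.
by apply/funext => ys; rewrite nth_default// size_tuple.
Qed.

Lemma measurable_observations m t :
  measurable_fun [set: alg_seedType A * m.-tuple (n.-tuple R)]
    (fun w => observations (@dotp R n) w.1 (nth x0 w.2) t).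
Proof.
elim: t => [|t IH]; first exact: measurable_cst.
have mq : measurable_fun [set: alg_seedType A * m.-tuple (n.-tuple R)]
    (fun w => alg_query A t (w.1, observations (@dotp R n) w.1 (nth x0 w.2) t)).
  apply: measurableT_comp => //; apply: measurable_fun_pair => //.
have mx : measurable_fun [set: alg_seedType A * m.-tuple (n.-tuple R)]
    (fun w => nth x0 w.2 t).
  by apply: (measurableT_comp (measurable_nth _ _)).
apply: measurable_rcons => //; apply: measurable_fun_pair.
- by apply: measurable_dotp => //; exact: (measurableT_comp measurable_fst mq).
- by apply: measurable_dotp => //; exact: (measurableT_comp measurable_snd mq).
Qed.

(** Backward induction on rounds with the seed fixed: averaging over the last sample turns a loss on
    [t.+1] observations into one on [t], and each round lowers [alpha] by [8 * eps ^+ 2 * beta]. *)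
Lemma bayes_bound_run (J : pred 'I_n) (sigma eps : R) u t alpha beta
    (h : {ffun 'I_n -> bool} -> t.-tuple (R * R) -> \bar R) :
  eps ^+ 2 <= 1 / 8 -> 0 <= beta ->
  0 <= alpha - t%:R * (8 * eps ^+ 2 * beta) ->
  (forall s, measurable_fun [set: t.-tuple (R * R)] (h s)) ->
  (forall s y, 0 <= h s y)%E ->
  (forall y, bayes_bound J alpha beta (h^~ y)) ->
  bayes_bound J (alpha - t%:R * (8 * eps ^+ 2 * beta)) beta
    (fun s => \int[iid (sample_law J sigma eps s) t]_xs
       h s (observations (A := A) (@dotp R n) u (nth x0 xs) t))%E.
Proof.
move=> eps8 b0; set c := 8 * eps ^+ 2 * beta.
have c0 : 0 <= c by apply: mulr_ge0 => //; rewrite mulr_ge0 ?sqr_ge0.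
have mobs j m : measurable_fun [set: m.-tuple (n.-tuple R)]
    (fun xs : m.-tuple (n.-tuple R) =>
      observations (A := A) (@dotp R n) u (nth x0 xs) j).
  exact: (measurable_fun_pair2 u (@measurable_observations m j)).
elim: t alpha h => [|t IH] alpha h a0 mh h0 hb.
  rewrite mul0r subr0; apply: le_bayes_bound (hb [tuple]) => s.
  rewrite le_eqVlt; apply/orP; left; apply/eqP/esym.
  by apply: integral_iid0; exact: (measurableT_comp (mh s)).
pose q ys := alg_query A t (u, ys).
have mq : measurable_fun [set: t.-tuple (R * R)] q.
  by apply: measurableT_comp => //; exact: pair1_measurable.
(* The expected loss given the first [t] observations; these and the seed determine the last pair of
   queries. *)
pose h' s (ys : t.-tuple (R * R)) := (\int[sample_law J sigma eps s]_x
  h s [tuple of rcons ys (dotp (q ys).1 x, dotp (q ys).2 x)])%E.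
have h'0 s ys : (0 <= h' s ys)%E by apply: integral_ge0 => x _; exact: h0.
have mh' s : measurable_fun [set: t.-tuple (R * R)] (h' s).
  apply: measurable_fun_integral_snd => [|ys x]; last exact: h0.
  apply: measurableT_comp => //; apply: measurable_rcons => //.
  have mq1 : measurable_fun [set: t.-tuple (R * R) * n.-tuple R] (q \o fst).
    exact: (measurableT_comp mq).
  apply: measurable_fun_pair.
  - by apply: measurable_dotp => //; exact: (measurableT_comp measurable_fst mq1).
  - by apply: measurable_dotp => //; exact: (measurableT_comp measurable_snd mq1).
have t0 : 0 <= t%:R * c by rewrite mulr_ge0.
have tS : alpha - t.+1%:R * c = alpha - c - t%:R * c.
  by rewrite -natr1; ring.
rewrite tS in a0 *.
have hb' ys : bayes_bound J (alpha - c) beta (h'^~ ys).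
  pose r y := [tuple of rcons ys y].
  have mr : measurable_fun [set: R * R] r by exact: measurable_rcons.
  apply: (@bayes_bound_round R n J sigma eps (q ys).1 (q ys).2 alpha beta
    (fun s y => h s (r y)) eps8 _ b0) => [|s|s y|y].
  - by lra.
  - exact: (measurableT_comp (mh s) mr).
  - exact: h0.
  - exact: hb.
apply: le_bayes_bound (IH _ _ a0 mh' h'0 hb') => s.
rewrite [in leRHS]ge0_integral_iid_rcons; last 2 first.
- exact: (measurableT_comp (mh s) (mobs _ _)).
- by move=> xs; exact: h0.
rewrite le_eqVlt; apply/orP; left; apply/eqP; apply: eq_integral => xs _.
by apply: eq_integral => x _; rewrite observations_rcons.
Qed.

End adaptive_run.

(** * Gaussian moments *)

Lemma expR_ge_quadratic (R : realType) (x : R) : 0 <= x ->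
  1 + x + x ^+ 2 / 2 <= expR x.
Proof.
move=> x0.
have nd : nondecreasing_seq (series (exp_coeff x)).
  by apply: nondecreasing_series => i _ _; exact: exp_coeff_ge0.
have := nondecreasing_cvgn_le nd (is_cvg_series_exp_coeff x) 3.
by rewrite /series/= !big_nat_recr//= big_geq// /exp_coeff/= add0r expr0 expr1 !divr1.
Qed.

(** With x = 2y the right-hand side is 2 + (exp y - exp(-y))^2, and exp y - exp(-y) >= 2y for y >=
    0. *)
Lemma expRDexpRN_ge (R : realType) (x : R) : 2 + x ^+ 2 <= expR x + expR (- x).
Proof.
wlog x0 : x / 0 <= x => [hw|].
  have [/hw//|xlt0] := leP 0 x.
  have := hw (- x); rewrite sqrrN opprK [expR (- x) + _]addrC; apply.
  by rewrite oppr_ge0 ltW.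
pose y := x / 2; have y0 : 0 <= y by rewrite divr_ge0.
have -> : x = y + y by rewrite /y; field.
rewrite opprD !expRD expRN.
set a := expR y; have a0 : 0 < a by exact: expR_gt0.
have ha : 2 * y <= a - a^-1.
  have : 1 + y + y ^+ 2 / 2 <= a by exact: expR_ge_quadratic.
  have -> : a - a^-1 = (a ^+ 2 - 1) / a by field; rewrite gt_eqF.
  by rewrite ler_pdivlMr// => ?; nra.
have -> : a * a + a^-1 * a^-1 = 2 + (a - a^-1) ^+ 2 by field; rewrite gt_eqF.
rewrite lerD2l -(mulr2n y) -[y *+ 2]mulr_natl ler_sqr ?nnegrE ?mulr_ge0//.
by rewrite (le_trans _ ha)// mulr_ge0.
Qed.

Lemma integral_probability_cst d (T : measurableType d) (R : realType)
    (P : probability T R) (c : R) : (\int[P]_x cst c%:E x = c%:E)%E.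
Proof.
rewrite integral_cst//; transitivity (c%:E * 1)%E; last by rewrite mule1.
by congr (_ * _)%E; exact: probability_setT.
Qed.

Section gauss_moments.
Context (R : realType) (n : nat) (i : 'I_n).

(** An exponential of one coordinate is a multiple of a shift density, which gives the moment
    generating function; the moments below are extracted from it. *)
Lemma expR_coordinate (t : R) (z : n.-tuple R) : expR (t * tnth z i) =
  expR (t ^+ 2 / 2) * shift_density (fun j => if j == i then t else 0) z.
Proof.
rewrite /shift_density -expRD (bigD1 i)//= eqxx big1 => [|j /negbTE->]; last first.
  by rewrite mul0r.
rewrite (bigD1 i)//= eqxx big1 => [|j /negbTE->]; last by rewrite expr0n.
by rewrite !addr0 addrC subrK.
Qed.

Lemma integrable_expR_coordinate (t : R) :
  (gauss R n).-integrable setT (fun z => (expR (t * tnth z i))%:E).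
Proof.
under eq_fun do rewrite expR_coordinate EFinM.
by apply: integrableZl; [exact: measurableT|exact: integrable_shift_density].
Qed.

Lemma integral_expR_coordinate (t : R) :
  (\int[gauss R n]_z (expR (t * tnth z i))%:E = (expR (t ^+ 2 / 2))%:E)%E.
Proof.
under eq_integral do rewrite expR_coordinate EFinM.
rewrite integralZl; last 2 first.
- exact: measurableT.
- exact: integrable_shift_density.
by rewrite integral_shift_density mule1.
Qed.

Lemma integrable_coordinate_sqr :
  (gauss R n).-integrable setT (fun z => (tnth z i ^+ 2)%:E).
Proof.
refine (@le_integrable _ _ _ (gauss R n) _ measurableT
    (fun z => (tnth z i ^+ 2)%:E)
    (fun z => (expR (1 * tnth z i))%:E + (expR (- 1 * tnth z i))%:E)%E _ _ _).
- by apply/measurable_EFinP; apply: measurable_funX; exact: measurable_tnth.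
- move=> z _; rewrite -EFinD /= lee_fin ger0_norm ?sqr_ge0//.
  rewrite ger0_norm ?addr_ge0 ?expR_ge0// mul1r mulN1r.
  by apply: le_trans (expRDexpRN_ge _); rewrite lerDr.
- by apply: integrableD => //; exact: integrable_expR_coordinate.
Qed.

Lemma integrable_coordinate :
  (gauss R n).-integrable setT (fun z => (tnth z i)%:E).
Proof.
refine (@le_integrable _ _ _ (gauss R n) _ measurableT
    (fun z => (tnth z i)%:E) (fun z => cst 1 z + (tnth z i ^+ 2)%:E)%E _ _ _).
- by apply/measurable_EFinP; exact: measurable_tnth.
- move=> z _; rewrite -EFinD /= lee_fin [leRHS]ger0_norm ?addr_ge0 ?sqr_ge0//.
  have := sqr_ge0 (`|tnth z i| - 1); have := normr_ge0 (tnth z i).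
  rewrite -[tnth z i ^+ 2]real_normK ?num_real// => h1 h2; nra.
- apply: integrableD => //; last exact: integrable_coordinate_sqr.
  exact: finite_measure_integrable_cst.
Qed.

(** Integrating tz <= exp(tz) - 1 bounds t times the mean by exp(t^2 / 2) - 1 <= t^2; divide by
    small t of either sign. *)
Lemma integral_coordinate : (\int[gauss R n]_z (tnth z i)%:E = 0)%E.
Proof.
have ifin := integrable_fin_num measurableT integrable_coordinate.
set I := (\int[_]_z _)%E in ifin *.
have bd (t : R) : t ^+ 2 <= 1 -> t * fine I <= t ^+ 2.
  move=> t1; rewrite -lee_fin EFinM fineK//.
  rewrite /I -integralZl//; last exact: integrable_coordinate.
  apply: (@le_trans _ _ (\int[gauss R n]_z
      ((expR (t * tnth z i))%:E - cst 1 z))%E).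
    apply: le_integral => //.
    - by apply: integrableZl => //; exact: integrable_coordinate.
    - apply: integrableB => //; first exact: integrable_expR_coordinate.
      exact: finite_measure_integrable_cst.
    - move=> z _; rewrite /= -EFinM -EFinB lee_fin.
      by have := expR_ge1Dx (t * tnth z i); lra.
  rewrite integralB//; last 2 first.
  - exact: integrable_expR_coordinate.
  - exact: finite_measure_integrable_cst.
  rewrite integral_expR_coordinate integral_probability_cst -EFinB lee_fin.
  have /expR_le1D2x : 0 <= t ^+ 2 / 2 <= 1 / 2.
    by have := sqr_ge0 t; move=> ?; apply/andP; split; lra.
  by lra.
rewrite -[I]fineK//; congr EFin; apply/eqP.
have key (x : R) : (forall t : R, 0 < t -> t <= 1 -> t * x <= t ^+ 2) -> x <= 0.
  move=> hx; apply/ler_addgt0Pl => e e0; rewrite addr0.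
  pose t := Num.min e 1.
  have t0 : 0 < t by rewrite lt_min e0 ltr01.
  have := hx t t0; rewrite ge_min lexx orbT => /(_ isT).
  rewrite expr2 ler_pM2l// => /le_trans; apply; by rewrite ge_min lexx.
rewrite eq_le; apply/andP; split.
  by apply: key => t t0 t1; apply: bd; rewrite expr_le1// ltW.
rewrite -oppr_le0; apply: key => t t0 t1.
by rewrite mulrN -mulNr -[leRHS]sqrrN; apply: bd; rewrite sqrrN expr_le1// ltW.
Qed.

(** Integrating t^2 z^2 <= exp(tz) + exp(-tz) - 2 with t^2 = 2x bounds x times the second moment by
    exp x - 1 <= x / (1 - x); then x is taken small. *)
Lemma integral_coordinate_sqr :
  (\int[gauss R n]_z (tnth z i ^+ 2)%:E <= 1)%E.
Proof.
have ifin := integrable_fin_num measurableT integrable_coordinate_sqr.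
set I := (\int[_]_z _)%E in ifin *.
have I0 : 0 <= fine I.
  apply: fine_ge0; apply: integral_ge0 => z _; rewrite lee_fin; exact: sqr_ge0.
have bd (x : R) : 0 < x -> x < 1 -> fine I * (1 - x) <= 1.
  move=> x0 x1.
  pose t := Num.sqrt (2 * x).
  have t2 : t ^+ 2 = 2 * x by rewrite sqr_sqrtr// mulr_ge0// ltW.
  have : t ^+ 2 * fine I <= 2 * expR x - 2.
    rewrite -lee_fin EFinM fineK//.
    rewrite /I -integralZl//; last exact: integrable_coordinate_sqr.
    apply: (@le_trans _ _ (\int[gauss R n]_z
      ((expR (t * tnth z i))%:E + (expR (- t * tnth z i))%:E - cst 2%:E z))%E).
      apply: le_integral => //.
      - by apply: integrableZl => //; exact: integrable_coordinate_sqr.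
      - apply: integrableB => //.
          by apply: integrableD => //; exact: integrable_expR_coordinate.
        exact: finite_measure_integrable_cst.
      - move=> z _; rewrite /= -EFinM -EFinD lee_fin.
        by have := expRDexpRN_ge (t * tnth z i); rewrite exprMn mulNr; lra.
    rewrite integralB//; last 2 first.
    - by apply: integrableD => //; exact: integrable_expR_coordinate.
    - exact: finite_measure_integrable_cst.
    rewrite integralD//; last 2 first.
    - exact: integrable_expR_coordinate.
    - exact: integrable_expR_coordinate.
    rewrite !integral_expR_coordinate integral_probability_cst.
    rewrite -EFinD lee_fin sqrrN t2.
    by rewrite [2 * x]mulrC mulfK//; lra.
  rewrite t2 => h.
  have : (1 - x) * expR x <= 1.
    rewrite -ler_pdivlMr ?expR_gt0// div1r -expRN; exact: expR_ge1Dx.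
  move: I0 h; move: (fine I) (expR x) => m e m0 h he.
  have xm : x * m <= e - 1 by lra.
  have := ler_wpM2r (ltac:(lra) : 0 <= 1 - x) xm.
  by move=> ?; rewrite -(ler_pM2l x0); lra.
rewrite -[I]fineK// lee_fin leNgt; apply/negP => I1.
(* For this [x] the product [fine I * (1 - x)] is [(fine I + 1) / 2], which exceeds 1. *)
pose x := (fine I - 1) / (2 * fine I).
have II : 0 < 2 * fine I by lra.
have := bd x; rewrite divr_gt0 ?subr_gt0// => /(_ isT).
rewrite ltr_pdivrMr// => /(_ ltac:(lra)).
rewrite /x mulrBr mulr1 mulrA [fine I * _]mulrC -mulrA.
rewrite (_ : fine I / (2 * fine I) = 2^-1); first by lra.
by rewrite invfM mulrCA mulfV ?mulr1// gt_eqF//; lra.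
Qed.

End gauss_moments.

(** * The hard distributions and the dual norm bound *)

Section sample_law_moments.
Context (R : realType) (n : nat) (J : pred 'I_n) (sigma eps : R).
Implicit Types (s : {ffun 'I_n -> bool}).

Lemma expectation_dotp_sample_law s th :
  ('E_(sample_law J sigma eps s)[@dotp R n th] =
   (sigma * eps * \sum_(i | J i) tnth th i * sgn R s i)%:E)%E.
Proof.
have mdotp : measurable_fun [set: n.-tuple R] (dotp th).
  by apply: measurable_dotp.
pose a := effective_query J sigma th.
have iz (i : 'I_n) : (gauss R n).-integrable setT
    (fun z => (a i * (tnth z i + eps * sgn R s i))%:E).
  have : (gauss R n).-integrable setT (fun z => (a i)%:E *
      ((tnth z i)%:E + cst (eps * sgn R s i)%:E z))%E.
    apply: integrableZl => //; apply: integrableD => //.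
      exact: integrable_coordinate.
    exact: finite_measure_integrable_cst.
  by apply: eq_integrable => // z _; rewrite -EFinD -EFinM.
have dE z : ((dotp th (sample J sigma eps s z))%:E =
    \sum_i (a i * (tnth z i + eps * sgn R s i))%:E)%E.
  by rewrite dotp_sample -sumEFin.
rewrite unlock integral_distribution; last 2 first.
- exact/measurable_EFinP.
- have : (gauss R n).-integrable setT (fun z =>
      \sum_i (a i * (tnth z i + eps * sgn R s i))%:E)%E.
    by apply: integrable_sum.
  by apply: eq_integrable => // z _; rewrite /= dE.
transitivity (\int[gauss R n]_z
    \sum_i (a i * (tnth z i + eps * sgn R s i))%:E)%E.
  by apply: eq_integral => z _; rewrite /= dE.
rewrite integral_sum//= mulr_sumr [in RHS]big_mkcond -sumEFin.
apply: eq_bigr => i _.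
transitivity ((a i)%:E *
    \int[gauss R n]_z ((tnth z i)%:E + cst (eps * sgn R s i)%:E z))%E.
  rewrite -integralZl//.
  - by apply: integrableD => //; [exact: integrable_coordinate
      |exact: finite_measure_integrable_cst].
rewrite integralD//; last 2 first.
- exact: integrable_coordinate.
- exact: finite_measure_integrable_cst.
rewrite integral_coordinate integral_probability_cst add0e -EFinM.
by rewrite /a /effective_query; case: (J i); rewrite ?mul0r//; congr EFin; ring.
Qed.

Lemma expectation_norm_sample_law s :
  ('E_(sample_law J sigma eps s)[fun x => (lqnorm 2%:E x ^+ 2)%R] <=
   (#|J|%:R * sigma ^+ 2 * (1 + eps ^+ 2))%:E)%E.
Proof.
have normE (x : n.-tuple R) : lqnorm 2%:E x ^+ 2 = \sum_i tnth x i ^+ 2.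
  rewrite /lqnorm powR12_sqrt; last by apply: sumr_ge0 => i _; exact: powR_ge0.
  rewrite sqr_sqrtr; last by apply: sumr_ge0 => i _; exact: powR_ge0.
  by apply: eq_bigr => i _; rewrite powR_mulrn// real_normK// num_real.
under eq_fun do rewrite normE.
rewrite unlock ge0_integral_distribution; last 2 first.
- apply/measurable_EFinP; apply: measurable_sum => i; apply: measurable_funX.
  exact: measurable_tnth.
- by move=> x; rewrite lee_fin; apply: sumr_ge0 => i _; exact: sqr_ge0.
pose g (i : 'I_n) (z : n.-tuple R) : \bar R := ((sigma ^+ 2)%:E *
  ((tnth z i ^+ 2)%:E + (2 * eps * sgn R s i)%:E * (tnth z i)%:E
    + cst (eps ^+ 2)%:E z))%E.
have ig' (i : 'I_n) : (gauss R n).-integrable setT (fun z : n.-tuple R =>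
  ((tnth z i ^+ 2)%:E + (2 * eps * sgn R s i)%:E * (tnth z i)%:E)%E).
  apply: integrableD => //; first exact: integrable_coordinate_sqr.
  by apply: integrableZl => //; exact: integrable_coordinate.
have ig i : (gauss R n).-integrable setT (g i).
  apply: integrableZl => //; apply: integrableD => //.
  exact: finite_measure_integrable_cst.
have gE i z : ((sigma * (tnth z i + eps * sgn R s i)) ^+ 2)%:E = g i z.
  rewrite /g /cst -!(EFinD, EFinM); congr EFin.
  have : sgn R s i ^+ 2 = 1 by rewrite /sgn sqrr_sign.
  move=> s1; apply/eqP; rewrite -subr_eq0; apply/eqP.
  transitivity (sigma ^+ 2 * eps ^+ 2 * (sgn R s i ^+ 2 - 1)); first by ring.
  by rewrite s1 subrr mulr0.
have gle i : (\int[gauss R n]_z g i z <= (sigma ^+ 2 * (1 + eps ^+ 2))%:E)%E.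
  rewrite integralZl//; last first.
    by apply: integrableD => //; exact: finite_measure_integrable_cst.
  rewrite integralD//; last exact: finite_measure_integrable_cst.
  rewrite integralD//; last 2 first.
  - exact: integrable_coordinate_sqr.
  - by apply: integrableZl => //; exact: integrable_coordinate.
  rewrite integralZl//; last exact: integrable_coordinate.
  rewrite integral_coordinate mule0 adde0 integral_probability_cst.
  rewrite (EFinM (sigma ^+ 2) (1 + _)) (EFinD 1 (eps ^+ 2)).
  apply: lee_wpmul2l; first by rewrite lee_fin sqr_ge0.
  by apply: leeD => //; exact: integral_coordinate_sqr.
apply: (@le_trans _ _ (\int[gauss R n]_z \sum_(i <- enum J) g i z)%E).
  rewrite le_eqVlt; apply/orP; left; apply/eqP; apply: eq_integral => z _ /=.
  rewrite -sumEFin big_enum/= [RHS]big_mkcond; apply: eq_bigr => i _.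
  rewrite tnth_mktuple -gE; case: ifPn => Ji; rewrite [in RHS]/in_mem/= ?Ji//.
  by rewrite (negbTE Ji) expr0n.
rewrite integral_sum//.
apply: (@le_trans _ _ (\sum_(i <- enum J) (sigma ^+ 2 * (1 + eps ^+ 2))%:E)%E).
  by apply: lee_sum => i _; exact: gle.
rewrite sumEFin big_enum/= sumr_const lee_fin -[leLHS]mulr_natl mulrA.
by [].
Qed.

End sample_law_moments.

Section minimax_weights.
Context (R : realType) (n : nat) (J : pred 'I_n).
Implicit Types (s : {ffun 'I_n -> bool}) (q : \bar R) (th : n.-tuple R).

(** Young's inequality for the product of [x] and 1; [p = 1] is separate, its conjugate exponent
    being infinite. *)
Lemma le_powR_Young (x p : R) : 0 <= x -> 1 <= p -> x <= x `^ p / p + (1 - p^-1).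
Proof.
move=> x0 p1; have p0 : 0 < p by exact: lt_le_trans p1.
have [->|p_neq1] := eqVneq p 1; first by rewrite powRr1// invr1; lra.
have pgt1 : 1 < p by rewrite lt_neqAle eq_sym p_neq1.
have q0 : 0 < 1 - p^-1 by rewrite subr_gt0 invf_lt1.
have := @conjugate_powR R x 1 p (1 - p^-1)^-1 x0 ler01 p0.
rewrite invr_gt0 invrK => /(_ q0); rewrite addrC subrK => /(_ erefl).
by rewrite mulr1 powR1 mul1r.
Qed.

(** Dividing the coordinates by c = r m^(-1/q), with m the size of [J], makes their q-th powers sum
    to at most m; Young's inequality is then applied to each. For infinite [q] the coordinates are
    at most [r]. *)
Lemma le_lqball_pairing q (r : R) th (a : 'I_n -> R) :
  (1 <= q)%E -> 0 < r -> (0 < #|J|)%N -> lqnorm q th <= r ->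
  (forall i, 0 <= a i <= 1) ->
  \sum_(i | J i) `|tnth th i| * a i <=
  r * #|J|%:R `^ (- fine q^-1) *
    (fine q^-1 * #|J|%:R + (1 - fine q^-1) * \sum_(i | J i) a i).
Proof.
case: q => [p| |//] hq r0 J0 thr a01; last first.
  rewrite invey/= mul0r add0r subr0 mul1r oppr0 powRr0 mulr1 mulr_sumr.
  apply: ler_sum => i _; have /andP[a0 _] := a01 i; rewrite ler_wpM2r//.
  by apply: le_trans thr; exact: le_bigmax.
have p1 : 1 <= p by rewrite lee_fin in hq.
have p0 : 0 < p by exact: lt_le_trans p1.
rewrite inver gt_eqF//=; set m := #|J|%:R : R.
have m0 : 0 < m by rewrite ltr0n.
set c := r * m `^ (- p^-1).
have c0 : 0 < c by rewrite mulr_gt0// powR_gt0.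
have cp : c `^ p = r `^ p / m.
  rewrite /c powRM ?ltW ?powR_gt0// -powRrM mulNr mulVf ?gt_eqF//.
  by rewrite powR_inv1// ltW.
have sum_le : \sum_(i | J i) (`|tnth th i| / c) `^ p <= m.
  under eq_bigr => i _ do
    rewrite powRM ?invr_ge0 ?(ltW c0)// -powR_inv1 ?(ltW c0)// powRAC.
  rewrite -mulr_suml powR_inv1 ?powR_ge0// ler_pdivrMr ?powR_gt0// cp.
  rewrite mulrCA mulfV ?gt_eqF// mulr1.
  apply: (@le_trans _ _ (\sum_i `|tnth th i| `^ p)).
    rewrite [leRHS](bigID J)/= lerDl; apply: sumr_ge0 => i _; exact: powR_ge0.
  have S0 : 0 <= \sum_i `|tnth th i| `^ p.
    by apply: sumr_ge0 => i _; exact: powR_ge0.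
  have := @ge0_ler_powR R p (ltW p0) _ _ _ _ thr.
  rewrite -powRrM mulVf ?gt_eqF// powRr1//; apply; rewrite nnegrE ?powR_ge0//.
  exact: ltW.
apply: (@le_trans _ _ (\sum_(i | J i)
    c * ((`|tnth th i| / c) `^ p / p + (1 - p^-1) * a i))).
  apply: ler_sum => i _; have /andP[a0 a1] := a01 i.
  rewrite (_ : _ * a i = c * (a i * (`|tnth th i| / c))); last first.
    by field; rewrite gt_eqF.
  rewrite ler_pM2l//.
  have xc0 : 0 <= `|tnth th i| / c by rewrite divr_ge0// ltW.
  apply: (le_trans (ler_wpM2l a0 (le_powR_Young xc0 p1))).
  (* The weight [a i <= 1] is dropped from the power term only. *)
  rewrite mulrDr [a i * (1 - _)]mulrC lerD2r ler_piMl//.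
  by rewrite divr_ge0 ?powR_ge0// ltW.
rewrite -mulr_sumr ler_pM2l// big_split/= -mulr_suml -mulr_sumr lerD2r.
by rewrite [leRHS]mulrC ler_wpM2r// invr_ge0 ltW.
Qed.

End minimax_weights.

Lemma fine_inve_itv (R : realType) (q : \bar R) :
  (1 <= q)%E -> 0 <= fine q^-1 <= 1.
Proof.
case: q => [p| |//]; last by rewrite invey/= lexx ler01.
rewrite lee_fin inver => p1; have p0 : 0 < p by exact: lt_le_trans p1.
by rewrite gt_eqF//= invr_ge0 invf_le1// p1 ltW.
Qed.

Section optimality_gap_bound.
Context (R : realType) (n : nat) (J : pred 'I_n).
Implicit Types (s : {ffun 'I_n -> bool}) (q : \bar R) (th : n.-tuple R).

(** Pairing [s] with its flip turns the sum into half the sum of signed differences x of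
    neighbouring weights; with y their sum, AM-GM gives |x| <= y/2 + x^2/(2y). *)
Lemma norm_sum_sgn_le (w : {ffun 'I_n -> bool} -> R) (j : 'I_n) :
  (forall s, 0 < w s) ->
  `|\sum_s w s * sgn R s j| <= (\sum_s w s) / 2 +
    (\sum_s (w s - w (flip j s)) ^+ 2 / (w s + w (flip j s))) / 4.
Proof.
move=> w0.
have -> : \sum_s w s * sgn R s j =
    (\sum_s (w s - w (flip j s)) * sgn R s j) / 2.
  rewrite [in RHS](eq_bigr (fun s => w s * sgn R s j + w (flip j s) * sgn R (flip j s) j)).
    by rewrite big_split/= (sum_flip j (fun s => w s * sgn R s j)); field.
  by move=> s _; rewrite sgn_flip eqxx; ring.
have AMGM s : `|(w s - w (flip j s)) * sgn R s j| <=
    (w s + w (flip j s)) / 2 +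
    (w s - w (flip j s)) ^+ 2 / (w s + w (flip j s)) / 2.
  rewrite normrM /sgn normr_sign mulr1.
  have N0 : 0 < w s + w (flip j s) by rewrite addr_gt0.
  move: (w s - _) (w s + _) N0 => x y y0.
  rewrite -subr_ge0 -[x ^+ 2]real_normK ?num_real//.
  rewrite (_ : _ - _ = (y - `|x|) ^+ 2 / y / 2).
    by rewrite !divr_ge0 ?sqr_ge0// ltW.
  by field; rewrite gt_eqF.
rewrite normrM [X in _ * X]ger0_norm// ler_pdivrMr//.
apply: (le_trans (ler_norm_sum _ _ _)).
apply: (le_trans (ler_sum _ (fun s _ => AMGM s))).
rewrite big_split/= -mulr_suml -mulr_suml big_split/= sum_flip.
by rewrite le_eqVlt; apply/orP; left; apply/eqP; field.
Qed.

(** For c = r m^(-1/q), with m the size of [J], this is the optimality gap under [s] divided by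
    [sigma * eps]. *)
Definition scaled_gap (c : R) th s : R :=
  c * #|J|%:R + \sum_(i | J i) tnth th i * sgn R s i.

Lemma scaled_gap_ge0 q (r : R) th s :
  (1 <= q)%E -> 0 < r -> (0 < #|J|)%N -> lqnorm q th <= r ->
  0 <= scaled_gap (r * #|J|%:R `^ (- fine q^-1)) th s.
Proof.
move=> hq r0 J0 thr.
have := @le_lqball_pairing R n J q r th (fun=> 1) hq r0 J0 thr.
rewrite ler01 lexx => /(_ (fun=> isT)); rewrite sumr_const -mulrDl addrC subrK mul1r.
under eq_bigr do rewrite mulr1.
move=> h; rewrite /scaled_gap -lerBlDr sub0r.
apply: le_trans h; rewrite -sumrN; apply: ler_sum => i _.
by rewrite (le_trans (ler_norm _))// normrN normrM /sgn normr_sign mulr1.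
Qed.

(** The pairing bound is used with [a i] the absolute posterior mean of sign [i]. The sum of these
    means is controlled by half the total weight per coordinate plus a quarter of the potential,
    whence the two constants. *)
Lemma bayes_bound_scaled_gap q (r : R) th :
  (1 <= q)%E -> 0 < r -> (0 < #|J|)%N -> lqnorm q th <= r ->
  let c := r * #|J|%:R `^ (- fine q^-1) in
  bayes_bound J (c * (1 - fine q^-1) * #|J|%:R / 2) (c * (1 - fine q^-1) / 4)
    (fun s => (scaled_gap c th s)%:E).
Proof.
move=> hq r0 J0 thr c w w0; set iq := fine q^-1.
have iq1 : 0 <= 1 - iq.
  by have /andP[_] := fine_inve_itv hq; rewrite subr_ge0.
have c0 : 0 <= c by rewrite mulr_ge0 ?powR_ge0// ltW.
have W0 : 0 < \sum_s w s.
  by rewrite (bigD1 [ffun=> true])//= ltr_pwDl// sumr_ge0// => s _; exact: ltW.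
set W := \sum_s w s in W0 *.
pose b i := \sum_s w s * sgn R s i.
have bW i : `|b i| <= W.
  apply: (le_trans (ler_norm_sum _ _ _)); apply: ler_sum => s _.
  by rewrite normrM /sgn normr_sign mulr1 gtr0_norm.
have a01 i : 0 <= `|b i| / W <= 1.
  apply/andP; split; first by apply: divr_ge0 => //; exact: ltW.
  by rewrite ler_pdivrMr// mul1r.
have := le_lqball_pairing hq r0 J0 thr a01; rewrite -/iq -/c.
under eq_bigr do rewrite mulrA.
rewrite -!mulr_suml => /(ler_wpM2r (ltW W0)).
rewrite divfK ?gt_eqF// => pair.
have sumb : \sum_(i | J i) `|b i| <= W / 2 * #|J|%:R + potential J w / 4.
  apply: (le_trans (ler_sum _ (fun i _ => norm_sum_sgn_le i w0))).
  by rewrite big_split/= sumr_const -mulr_suml -[X in X + _]mulr_natr.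
have gapE : \sum_s w s * scaled_gap c th s =
    c * #|J|%:R * W + \sum_(i | J i) tnth th i * b i.
  rewrite /scaled_gap; under eq_bigr do rewrite mulrDr mulrC.
  rewrite big_split/= -mulr_sumr; congr +%R.
  under eq_bigr do rewrite mulr_sumr.
  rewrite exchange_big/=; apply: eq_bigr => i _; rewrite mulr_sumr.
  by apply: eq_bigr => s _; rewrite mulrCA.
have thb : - \sum_(i | J i) `|tnth th i| * `|b i| <= \sum_(i | J i) tnth th i * b i.
  rewrite -sumrN; apply: ler_sum => i _.
  by rewrite -normrM lerNl (le_trans (ler_norm _))// normrN.
under eq_bigr do rewrite -EFinM.
rewrite sumEFin -EFinD lee_fin gapE.
have := ler_wpM2l (mulr_ge0 c0 iq1) sumb.
move: pair; rewrite mulrDr mulrDl mulrDr mulrA.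
set S := \sum_(i | J i) `|b i|; set T := \sum_(i | J i) _ * `|b i| in thb *.
set U := \sum_(i | J i) _ in thb *.
rewrite (_ : c * ((1 - iq) * (S / W)) * W = c * (1 - iq) * S); last first.
  by field; rewrite gt_eqF.
move=> h1 h2; lra.
Qed.

End optimality_gap_bound.

(** * Assembly *)

Section sign_vertex.
Context (R : realType) (n : nat) (J : pred 'I_n).

(** For c = r m^(-1/q), with m the size of [J], a minimiser of the objective over the ball under
    [s]. *)
Definition vertex (c : R) (s : {ffun 'I_n -> bool}) : n.-tuple R :=
  [tuple if J i then - (c * sgn R s i) else 0 | i < n].

Lemma lqnorm_vertex q (r : R) s : (1 <= q)%E -> 0 < r -> (0 < #|J|)%N ->
  lqnorm q (vertex (r * #|J|%:R `^ (- fine q^-1)) s) <= r.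
Proof.
set m := #|J|%:R : R.
case: q => [p| |//] hq r0 J0; last first.
  rewrite invey/= oppr0 powRr0 mulr1.
  apply/bigmax_leP; split => [|i _]; first exact: ltW.
  rewrite tnth_mktuple; case: ifP => _; last by rewrite normr0 ltW.
  by rewrite normrN normrM /sgn normr_sign mulr1 gtr0_norm.
have m0 : 0 < m by rewrite ltr0n.
have p0 : 0 < p by apply: (lt_le_trans ltr01); rewrite lee_fin in hq.
rewrite inver gt_eqF//=; set c := r * _.
have c0 : 0 < c by rewrite mulr_gt0// powR_gt0.
rewrite (_ : \sum_(i < n) _ = r `^ p).
  by rewrite -powRrM mulfV ?gt_eqF// powRr1// ltW.
transitivity (\sum_(i | J i) c `^ p).
  rewrite [RHS]big_mkcond; apply: eq_bigr => i _; rewrite tnth_mktuple.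
  case: ifP => _; last by rewrite normr0 powR0// gt_eqF.
  by rewrite normrN normrM /sgn normr_sign mulr1 gtr0_norm.
rewrite sumr_const /c powRM ?powR_ge0 ?(ltW r0)// -powRrM mulNr mulVf ?gt_eqF//.
by rewrite powR_inv1 ?(ltW m0)// -mulr_natr -mulrA mulVf ?mulr1// gt_eqF.
Qed.

End sign_vertex.

(** * Average gap of an algorithm over the sign vectors *)

Section minimax_lower_bound.
Context (R : realType) (d k : nat) (q : \bar R) (r sigma eps : R).
Context (J : pred 'I_d) (A : algorithm k (lqball (d := d) q r)).
Hypotheses (hq : (1 <= q)%E) (hr : 0 < r) (hJ : (0 < #|J|)%N).
Hypotheses (sigma0 : 0 <= sigma) (eps0 : 0 <= eps).
Local Notation law := (sample_law J sigma eps).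
Local Notation c := (r * #|J|%:R `^ (- fine q^-1)).
Local Notation est := (estimate (A := A) (@dotp R d)).
Local Notation x0 := ([tuple of nseq d 0] : d.-tuple R).

Lemma measurable_scaled_gap d' (T : measurableType d') (f : T -> d.-tuple R) s :
  measurable_fun setT f -> measurable_fun setT (fun x => scaled_gap J c (f x) s).
Proof.
move=> mf; apply: measurable_funD => //.
under eq_fun do rewrite big_mkcond /=.
apply: measurable_sum => i; case: (J i) => //; apply: measurable_funM => //.
exact: (measurableT_comp (measurable_tnth i)).
Qed.

Lemma measurable_est : measurable_fun setT est.
Proof.
apply: measurableT_comp => //; apply: measurable_fun_pair => //.
exact: measurable_observations.
Qed.

(** The vertex lies in the ball, so its value bounds the infimum from above; the difference of
    objectives is the scaled gap times [sigma * eps]. *)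
Lemma optimality_gap_ge s :
  (\int[alg_seed A \x iid (law s) k]_w (sigma * eps * scaled_gap J c (est w) s)%:E
   <= optimality_gap A (@dotp R d, law s))%E.
Proof.
have se0 : 0 <= sigma * eps by rewrite mulr_ge0.
set inf := ereal_inf [set objective (@dotp R d) (law s) th | th in lqball q r].
have gap_ge th : ((sigma * eps * scaled_gap J c th s)%:E <=
    objective (@dotp R d) (law s) th - inf)%E.
  have : (inf <= objective (@dotp R d) (law s) (vertex J c s))%E.
    by apply: ereal_inf_lbound; exists (vertex J c s) => //; exact: lqnorm_vertex.
  rewrite /objective !expectation_dotp_sample_law => h.
  apply: le_trans (leeB (lexx _) h); rewrite -EFinB lee_fin -mulrBr.
  rewrite ler_wpM2l// /scaled_gap addrC lerD2l -sumrN.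
  rewrite (eq_bigr (fun=> c)) => [|i Ji]; last first.
    rewrite tnth_mktuple Ji; transitivity (c * sgn R s i ^+ 2); first by ring.
    by rewrite /sgn sqrr_sign mulr1.
  by rewrite sumr_const mulr_natr.
apply: ge0_le_integral.
- exact: measurableT.
- move=> w _; rewrite lee_fin mulr_ge0//; apply: scaled_gap_ge0 => //.
  exact: (alg_outputP (a := A)).
- apply/measurable_EFinP; apply: measurable_funM => //.
  by apply: measurable_scaled_gap; exact: measurable_est.
- apply: emeasurable_funB; last exact: measurable_cst.
  rewrite /objective; under eq_fun do rewrite expectation_dotp_sample_law.
  apply/measurable_EFinP; apply: measurable_funM => //.
  under eq_fun do rewrite big_mkcond /=.
  apply: measurable_sum => i; case: (J i) => //; apply: measurable_funM => //.
  by apply: (measurableT_comp (measurable_tnth i)); exact: measurable_est.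
- by move=> w _; exact: gap_ge.
Qed.

(** Tonelli isolates the seed; for each seed the bound on adaptive runs applies, and it does not
    depend on the seed. *)
Lemma sum_integral_scaled_gap_ge : eps ^+ 2 <= 1 / 8 ->
  0 <= #|J|%:R / 2 - k%:R * (8 * eps ^+ 2) / 4 ->
  ((c * (1 - fine q^-1) * (#|J|%:R / 2 - k%:R * (8 * eps ^+ 2) / 4) *
    #|{ffun 'I_d -> bool}|%:R)%:E <=
   \sum_s \int[alg_seed A \x iid (law s) k]_w (scaled_gap J c (est w) s)%:E)%E.
Proof.
move=> eps8 m0.
have c0 : 0 <= c by rewrite mulr_ge0 ?powR_ge0// ltW.
have iq0 : 0 <= 1 - fine q^-1.
  by have /andP[_] := fine_inve_itv hq; rewrite subr_ge0.
have g0 s w : (0 <= (scaled_gap J c (est w) s)%:E)%E.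
  by rewrite lee_fin; apply: scaled_gap_ge0 => //; exact: (alg_outputP (a := A)).
have mg s : measurable_fun setT (fun w => (scaled_gap J c (est w) s)%:E).
  apply/measurable_EFinP; apply: measurable_scaled_gap; exact: measurable_est.
pose h u s ys := (scaled_gap J c (alg_output A (u, ys)) s)%:E.
have h0 u s ys : (0 <= h u s ys)%E.
  by rewrite lee_fin; apply: scaled_gap_ge0 => //; exact: (alg_outputP (a := A)).
have mh u s : measurable_fun setT (h u s).
  apply/measurable_EFinP; apply: measurable_scaled_gap.
  by apply: measurableT_comp => //; exact: pair1_measurable.
pose F s u := (\int[iid (law s) k]_xs
  h u s (observations (A := A) (@dotp R d) u (nth x0 xs) k))%E.
have F0 s u : (0 <= F s u)%E by apply: integral_ge0 => xs _; exact: h0.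
have mF s : measurable_fun setT (F s).
  by apply: measurable_fun_integral_snd => [|u xs]; [exact: mg|exact: h0].
have -> : (\sum_s \int[alg_seed A \x iid (law s) k]_w
    (scaled_gap J c (est w) s)%:E = \int[alg_seed A]_u \sum_s F s u)%E.
  rewrite ge0_integral_sum; last 3 first.
  - exact: measurableT.
  - exact: mF.
  - by move=> s u _; exact: F0.
  apply: eq_bigr => s _; apply: (fubini_tonelli1 (m1 := alg_seed A)
    (m2 := iid (law s) k) _ (mg s)); exact: g0.
set L := (X in (X%:E <= _)%E).
rewrite -(integral_probability_cst (alg_seed A) L).
have beta0 : 0 <= c * (1 - fine q^-1) / 4.
  by rewrite divr_ge0// mulr_ge0.
apply: ge0_le_integral.
- exact: measurableT.
- move=> u _; rewrite lee_fin /L mulr_ge0// mulr_ge0//.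
  exact: mulr_ge0.
- exact: measurable_cst.
- by apply: emeasurable_sum => s; exact: mF.
move=> u _.
have alphaE : c * (1 - fine q^-1) * #|J|%:R / 2 -
    k%:R * (8 * eps ^+ 2 * (c * (1 - fine q^-1) / 4)) =
    c * (1 - fine q^-1) * (#|J|%:R / 2 - k%:R * (8 * eps ^+ 2) / 4).
  by field.
have := @bayes_bound_run R d k _ A J sigma eps u k _ _ (h u) eps8 beta0.
move=> /(_ (c * (1 - fine q^-1) * #|J|%:R / 2)); rewrite alphaE.
move=> /(_ (mulr_ge0 (mulr_ge0 c0 iq0) m0) (mh u) (h0 u)).
have hb ys : bayes_bound J (c * (1 - fine q^-1) * #|J|%:R / 2)
    (c * (1 - fine q^-1) / 4) ((h u)^~ ys).
  by apply: bayes_bound_scaled_gap => //; exact: (alg_outputP (a := A)).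
(* Under the uniform prior the potential vanishes and the total weight is the number of sign
   vectors. *)
move=> /(_ hb (fun=> 1) (fun=> ltr01)).
rewrite potential_cst mulr0 adde0 sumr_const /L.
by under eq_bigr do rewrite mul1e.
Qed.

End minimax_lower_bound.

Theorem proposition1 (R : realType) (d k : nat) (q : \bar R) (G r : R)
    (hd : (1 <= d)%N) (hk : (1 <= k)%N) (hq : (1 <= q)%E)
    (hG : 0 < G) (hr : 0 < r) :
  ((1 / 12 * (1 - fine q^-1) * (G * r / Num.sqrt k%:R)
    * Num.min (d%:R `^ (1 - fine q^-1)) (k%:R `^ (1 - fine q^-1)))%:E
   <= minimax_error k (linear_class d G) (lqball q r))%E.
Proof.
set iq := fine q^-1.
have iq0 : 0 <= 1 - iq.
  by have /andP[_] := fine_inve_itv hq; rewrite subr_ge0.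
pose m := minn d k; pose J : pred 'I_d := fun i => (i < m)%N.
have cardJ : #|J| = m.
  rewrite -sum1_card (big_ord_narrow (geq_minl d k)) sum1_card.
  exact: card_ord.
have m_gt0 : (0 < m)%N by rewrite leq_min hd.
have m0 : 0 < m%:R :> R by rewrite ltr0n.
have k0 : 0 < k%:R :> R by rewrite ltr0n.
have mk : m%:R <= k%:R :> R by rewrite ler_nat geq_minr.
(* With this choice [k] rounds use up m/4 of the m/2 available, and [m <= k] yields
   [eps ^+ 2 <= 1 / 8]. *)
pose eps : R := Num.sqrt (m%:R / (8 * k%:R)).
(* The factor 8/9 compensates [1 + eps ^+ 2 <= 9 / 8] in the second moment. *)
pose sigma : R := G * Num.sqrt (8 / (9 * m%:R)).
have eps2 : eps ^+ 2 = m%:R / (8 * k%:R).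
  by rewrite sqr_sqrtr// divr_ge0 ?mulr_ge0 ?ltW.
have sigma2 : sigma ^+ 2 = G ^+ 2 * (8 / (9 * m%:R)).
  by rewrite exprMn sqr_sqrtr// divr_ge0// mulr_ge0// ltW.
have eps8 : eps ^+ 2 <= 1 / 8.
  rewrite eps2 ler_pdivrMr ?mulr_gt0//; lra.
have eps0 : 0 <= eps by exact: sqrtr_ge0.
have sigma0 : 0 <= sigma by rewrite mulr_ge0 ?sqrtr_ge0// ltW.
have sigma_eps : sigma * eps = G / (3 * Num.sqrt k%:R).
  have sk0 : 0 < Num.sqrt k%:R :> R by rewrite sqrtr_gt0.
  apply/eqP; rewrite -(@eqrXn2 _ 2)//; last 2 first.
  - exact: mulr_ge0.
  - by rewrite divr_ge0 ?mulr_ge0 ?ltW.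
  rewrite exprMn sigma2 eps2 expr_div_n exprMn sqr_sqrtr ?(ltW k0)//.
  by apply/eqP; field; rewrite !gt_eqF.
pose c := r * #|J|%:R `^ (- iq).
have c0 : 0 <= c by rewrite mulr_ge0 ?powR_ge0// ltW.
have cm : c * m%:R = r * m%:R `^ (1 - iq).
  rewrite /c cardJ -mulrA; congr (_ * _).
  by rewrite powRD ?(gt_eqF m0) ?implybT// powRr1 ?(ltW m0)// mulrC.
have min_le : Num.min (d%:R `^ (1 - iq)) (k%:R `^ (1 - iq)) <= m%:R `^ (1 - iq).
  by rewrite /m /minn ge_min; case: ifP => _; rewrite lexx ?orbT.
apply: le_ereal_inf_tmp => _ [A ->].
set M := ereal_sup _.
pose law s := sample_law J sigma eps s.
have in_class s : linear_class d G (@dotp R d, law s).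
  split=> //=; apply: le_trans (expectation_norm_sample_law _ _ _ _) _.
  rewrite lee_fin cardJ sigma2.
  rewrite (_ : _ * _ * _ = G ^+ 2 * (8 / 9 * (1 + eps ^+ 2))); last first.
    by field; rewrite gt_eqF.
  rewrite -[leRHS]mulr1 ler_wpM2l ?sqr_ge0//; lra.
have gap_le s : (optimality_gap A (@dotp R d, law s) <= M)%E.
  by apply: ereal_sup_ubound; exists (@dotp R d, law s).
have J0 : (0 < #|J|)%N by rewrite cardJ.
have mE : #|J|%:R / 2 - k%:R * (8 * eps ^+ 2) / 4 = m%:R / 4.
  by rewrite cardJ eps2; field; rewrite gt_eqF.
have := @sum_integral_scaled_gap_ge R d k q r sigma eps J A hq hr J0 eps8.
rewrite mE -/iq -/c => /(_ (ltW (divr_gt0 m0 _))) => /(_ ltac:(by [])).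
set N := #|{ffun 'I_d -> bool}|.
have N0 : 0 < N%:R :> R.
  by rewrite ltr0n; apply/card_gt0P; exists [ffun=> true].
move=> avg.
have se0 : 0 <= sigma * eps by exact: mulr_ge0.
(* The supremum dominates the gap at every sign vector, hence their average. *)
have NM : ((sigma * eps)%:E * (c * (1 - iq) * (m%:R / 4) * N%:R)%:E <=
    \sum_(s : {ffun 'I_d -> bool}) M)%E.
  have se0' : (0 <= (sigma * eps)%:E)%E by rewrite lee_fin.
  refine (le_trans (lee_wpmul2l se0' avg) _).
  rewrite ge0_sume_distrr; last first.
    move=> s _; apply: integral_ge0 => w _; rewrite lee_fin.
    by apply: scaled_gap_ge0 => //; exact: (alg_outputP (a := A)).
  apply: lee_sum => s _; apply: le_trans (gap_le s).
  refine (le_trans _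
    (@optimality_gap_ge R d k q r sigma eps J A hq hr J0 sigma0 eps0 s)).
  rewrite -ge0_integralZl_EFin//.
  - by move=> w _; rewrite lee_fin; apply: scaled_gap_ge0 => //;
      exact: (alg_outputP (a := A)).
  - apply/measurable_EFinP; apply: measurable_scaled_gap.
    exact: measurable_est.
(* The constant 1/12 is 1/3 from [sigma * eps] times the remaining 1/4. *)
have L_le : 1 / 12 * (1 - iq) * (G * r / Num.sqrt k%:R) *
    Num.min (d%:R `^ (1 - iq)) (k%:R `^ (1 - iq)) <=
    sigma * eps * (c * (1 - iq) * (m%:R / 4)).
  have sk0 : 0 < Num.sqrt k%:R :> R by rewrite sqrtr_gt0.
  rewrite sigma_eps (_ : c * _ * _ = (1 - iq) / 4 * (c * m%:R)); last by field.
  rewrite cm (_ : _ * (_ / 4 * _) =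
    1 / 12 * (1 - iq) * (G * r / Num.sqrt k%:R) * m%:R `^ (1 - iq)).
    rewrite ler_wpM2l// mulr_ge0 ?mulr_ge0 ?divr_ge0 ?mulr_ge0//; exact: ltW.
  by field; rewrite gt_eqF.
apply: (@le_trans _ _ (sigma * eps * (c * (1 - iq) * (m%:R / 4)))%:E).
  by rewrite lee_fin.
move: NM; rewrite -EFinM mulrA.
(* An infinite supremum is trivial, and -oo is impossible because the gaps are nonnegative. *)
case: M gap_le => [x _|_ _|]; last 2 first.
- exact: leey.
- move=> gap_le; exfalso.
  have := le_trans
    (@optimality_gap_ge R d k q r sigma eps J A hq hr J0 sigma0 eps0
      [ffun=> true])
    (gap_le [ffun=> true]).
  rewrite leNgt => /negP; apply; apply: (lt_le_trans (ltNyr 0)).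
  apply: integral_ge0 => w _; rewrite lee_fin; apply: mulr_ge0 => //.
  by apply: scaled_gap_ge0 => //; exact: (alg_outputP (a := A)).
rewrite sumEFin sumr_const !lee_fin -[x *+ _]mulr_natr -/N !mulrA.
by rewrite ler_pM2r.
Qed.
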